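(* For every constant $d>1$ there are constants $\alpha,\beta>0$ such that for every positive integer $r$ there are constants $c,C>0$ with the following property. If $G\sim\mathcal{G}(n,p)$ with $p=p(n)$ satisfying $$\left(\frac{C\log n}{n}\right)^{\frac1r}<p<\left(\frac{c\log n}{n}\right)^{\frac{1}{d(r+1)}},$$ then w.h.p. $\alpha r^2\le \mathrm{tc}_r(G)\le\beta r^2$ (that is, $\mathrm{tc}_r(G)=\Theta(r^2)$).
   Context: $\mathcal{G}(n,p)$ is the binomial random graph on $n$ vertices, in which each pair of vertices is an edge independently with probability $p=p(n)$. ''W.h.p.'' means with probability tending to $1$ as $n\to\infty$. $\log$ is the natural logarithm. For a graph $G$, $\mathrm{tc}_r(G)$ is the minimum $m$ such that for every colouring of the edges of $G$ with $r$ colours there is a collection of at most $m$ monochromatic trees in $G$ (subgraphs that are trees all of whose edges have the same colour; a single vertex counts as a monochromatic tree) that together cover all vertices of $G$. Trees may overlap. Equivalently, ''tree'' may be replaced by ''monochromatic connected component'', i.e. a connected component of the spanning subgraph formed by the edges of one colour (singleton components allowed). *)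

(* Defs.v *)
From HB Require Import structures.
From mathcomp Require Import all_boot all_order all_algebra.
From mathcomp Require Import boolp reals.

Set Implicit Arguments.
Unset Strict Implicit.
Unset Printing Implicit Defensive.

Import Order.TTheory GRing.Theory Num.Theory.

(* A simple graph on the vertex type T is given by its edge set
   E \subset pairs T; a subgraph is a pair (vertex set, edge set). *)
Section Graphs.
Variable T : finType.

Definition pairs : {set {set T}} := [set e : {set T} | #|e| == 2].

Definition adj (F : {set {set T}}) : rel T := fun x y => [set x; y] \in F.

Definition subgraph (E : {set {set T}}) (H : {set T} * {set {set T}}) : Prop :=
  H.2 \subset E /\ {in H.2, forall e : {set T}, e \subset H.1}.

Definition acyclic (F : {set {set T}}) : Prop :=
  forall s : seq T, 2 < size s -> ~ ucycle (adj F) s.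

(* As the edges of a subgraph H lie inside H.1, the paths considered by connect
   between two vertices of H.1 stay in H.1. *)
Definition tree (H : {set T} * {set {set T}}) : Prop :=
  [/\ H.1 != set0,
      {in H.1 &, forall x y, connect (adj H.2) x y}
    & acyclic H.2].

Section Cover.
Variable r : nat.

(* A colouring is a total function on {set T}; only its values on the edges of
   the graph at hand matter. *)
Definition mono_tree (E : {set {set T}}) (col : {set T} -> 'I_r)
    (H : {set T} * {set {set T}}) : Prop :=
  [/\ subgraph E H, tree H & {in H.2 &, forall e f, col e = col f}].

Definition tree_coverable (E : {set {set T}}) (m : nat) : Prop :=
  forall col : {set T} -> 'I_r,
  exists C : {set {set T} * {set {set T}}},
    [/\ #|C| <= m,
        forall H, H \in C -> mono_tree E col H
      & \bigcup_(H in C) H.1 = [set: T]].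

Lemma tree_coverable_ex (E : {set {set T}}) :
  exists m, `[< tree_coverable E m >].
Proof.
exists #|T|; apply/asboolP => col.
exists [set ([set x], set0) | x : T]; split.
- by rewrite (leq_trans (leq_imset_card _ _)) // max_card.
- move=> _ /imsetP[x _ ->]; split => /=.
  + by split; [exact: sub0set | move=> e; rewrite inE].
  + split => /=; first by apply/set0Pn; exists x; rewrite inE.
    * by move=> y z; rewrite !inE => /eqP-> /eqP->; exact: connect0.
    * by case=> [|y [|z s]] // _ /andP[/andP[]]; rewrite /adj inE.
  + by move=> e f; rewrite inE.
- apply/setP => x; rewrite inE; apply/bigcupP.
  by exists ([set x], set0); [apply/imsetP; exists x | rewrite inE].
Qed.

Definition tc (E : {set {set T}}) : nat := ex_minn (tree_coverable_ex E).

End Cover.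
End Graphs.

Local Open Scope ring_scope.

Definition gnp_mass (R : realType) (n : nat) (p : R)
    (E : {set {set 'I_n}}) : R :=
  \prod_(e in pairs 'I_n) (if e \in E then p else 1 - p).

Definition gnp_prob (R : realType) (n : nat) (p : R)
    (A : pred {set {set 'I_n}}) : R :=
  \sum_(E : {set {set 'I_n}} | (E \subset pairs 'I_n) && A E) gnp_mass p E.

(* Main.v *)
Require Import Defs.
From mathcomp Require Import all_boot all_order all_algebra.
From mathcomp Require Import boolp classical_sets reals topology normedtype sequences exp.
From mathcomp Require Import ring lra zify.
From mathcomp Require Import fintype finset.

(** The two bounds are proved separately, each from a property that the
random graph has with high probability.

Upper bound. Fix a colouring of a graph on n vertices. Call a component big
when it has at least n / (2 r) vertices; a colour has at most 2 r big
components, so at most 2 r ^ 2 of them cover all but a set X of vertices.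
Choose a maximal set M of vertices in X no two of which share a
component. By maximality the components of the vertices of M cover X, so it
suffices that #|M| < 2 r, and then 4 r ^ 2 trees are enough.  Otherwise
take 2 r vertices v_i in M. A cell consists of the vertices whose component
of every colour c is that of some v_(s c); there are (2 r) ^ r choices of s.
Let W be a largest cell and let U consist of r - 1 vertices v_i that s does
not use. A vertex adjacent to all of U and to some vertex of W has edges of
r different colours to U and W, so it lies in a cell as well; there are thus
at most (2 r) ^ r * #|W| such vertices. When p ^ r n is a large multiple of
log n, the random graph has more of them as long as #|W| is at most about
4 / p. Hence W is larger than that. But the components that meet W are not
big, so at least half of all vertices share no component with W, and there
is no edge from W to them, which is again false in the random graph. This is
no_small_matching, followed by cover_by_components and tc_upper.

Lower bound. Let q be about r / 4 and let b be a small constant times q.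
Consider 4 q blocks of b points and the partial transversals, which pick
one point in all but at most q blocks. A set of points that meets all of
them must contain more than q whole blocks, so it has at least (q + 1) b
points. On the other hand, for an integer D >= d, any D (r + 1) partial
transversals are met by a single full transversal: a random choice in half of the blocks misses at
most q of them, and those are met one by one in the other half.  Since
n p ^ (D (r + 1)) is at most a small multiple of log n, the random graph
contains an independent set indexed by the partial transversals such that
every vertex w has fewer than D (r + 1) neighbours in it. Colour the edge
from w to the vertex of f by a block in which f meets the full transversal
chosen for w, and all other edges by one further colour. A monochromatic
tree then covers only vertices of the independent set whose partial
transversals share a point, so at least (q + 1) b trees are needed. This is
exists_transversal, exists_bad_colouring and tc_lower; the independent set
comes from prob_candidate.

For both properties of the random graph the point is that events which
depend on disjoint sets of edges are independent (bprob_forall), and that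
the stars from distinct vertices to a set avoiding them are disjoint. *)

Set Implicit Arguments.
Unset Strict Implicit.
Unset Printing Implicit Defensive.

Import Order.TTheory GRing.Theory Num.Theory numFieldNormedType.Exports.
Local Open Scope ring_scope.

(** * The random subset of a finite set *)

Section BinomialSubset.
Variables (R : realType) (T : finType) (p : R).
Implicit Types (P D E : {set T}) (f g : {set T} -> R).

Definition bweight P E : R := \prod_(e in P) (if e \in E then p else 1 - p).

(** The expectation of f E, where E is the random subset of P that contains
each element of P independently with probability p. *)
Definition bexp P f : R := \sum_(E : {set T} | E \subset P) bweight P E * f E.

Lemma eq_bexp P f g : (forall E, E \subset P -> f E = g E) -> bexp P f = bexp P g.
Proof. by move=> fg; apply: eq_bigr => E EP; rewrite fg. Qed.

Lemma bexpZ P (x : R) f : bexp P (fun E => x * f E) = x * bexp P f.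
Proof. by rewrite /bexp mulr_sumr; apply: eq_bigr => E _; rewrite mulrCA. Qed.

Lemma bexp_sum P (I : finType) (A : pred I) (f : I -> {set T} -> R) :
  bexp P (fun E => \sum_(i | A i) f i E) = \sum_(i | A i) bexp P (f i).
Proof.
rewrite /bexp exchange_big /=; apply: eq_bigr => E _.
by rewrite mulr_sumr.
Qed.

Lemma bexpB P f g : bexp P (fun E => f E - g E) = bexp P f - bexp P g.
Proof. by rewrite /bexp -sumrB; apply: eq_bigr => E _; rewrite mulrBr. Qed.

(** Fubini: the traces of the random set on disjoint sets are drawn
independently of each other. *)
Lemma bexp_split P1 P2 f : [disjoint P1 & P2] ->
  bexp (P1 :|: P2) f = bexp P1 (fun E1 => bexp P2 (fun E2 => f (E1 :|: E2))).
Proof.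
move=> dis; rewrite /bexp.
under [RHS]eq_bigr do rewrite mulr_sumr.
rewrite pair_big /=.
have dis2 : P2 :&: P1 = set0 by apply/eqP; rewrite setI_eq0 disjoint_sym.
have dis1 : P1 :&: P2 = set0 by rewrite setIC.
rewrite (reindex_onto (fun u : {set T} * {set T} => u.1 :|: u.2)
                      (fun E => (E :&: P1, E :&: P2))) /=; last first.
  by move=> E EP; rewrite -setIUr; apply/setIidPl.
apply: eq_big => [[E1 E2] | [E1 E2]] /=.
- rewrite xpair_eqE !setIUl subUset.
  apply/idP/idP.
    by move=> /andP[_ /andP[/eqP<- /eqP<-]]; rewrite !subUset !subsetIr.
  move=> /andP[E1P E2P].
  have -> : E2 :&: P1 = set0.
    by apply/eqP; rewrite -subset0 -dis2; apply: setSI.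
  have -> : E1 :&: P2 = set0.
    by apply/eqP; rewrite -subset0 -dis1; apply: setSI.
  rewrite setU0 set0U (setIidPl E1P) (setIidPl E2P) !eqxx !andbT.
  by rewrite (subset_trans E1P (subsetUl _ _)) (subset_trans E2P (subsetUr _ _)).
- move=> /andP[_ /eqP[]]; rewrite !setIUl => e1 e2.
  have E1P : E1 \subset P1 by rewrite -e1 subUset !subsetIr.
  have E2P : E2 \subset P2 by rewrite -e2 subUset !subsetIr.
  rewrite mulrA; congr (_ * _).
  rewrite /bweight (big_setID P1) /=; congr (_ * _).
    rewrite setUK; apply: eq_bigr => e eP1; rewrite inE.
    case: (boolP (e \in E2)) => [/(subsetP E2P) eP2|]; last by rewrite orbF.
    by move: (disjointFr dis eP1); rewrite eP2.
  rewrite setDUl setDv set0U (setDidPl _); last by rewrite disjoint_sym.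
  apply: eq_bigr => e eP2; rewrite inE.
  case: (boolP (e \in E1)) => //= /(subsetP E1P) eP1.
  by move: (disjointFr dis eP1); rewrite eP2.
Qed.

Lemma bexp_set1 e f : bexp [set e] f = p * f [set e] + (1 - p) * f set0.
Proof.
rewrite /bexp (bigD1 [set e]) //= (bigD1 set0) /=; last first.
  by rewrite sub0set eq_sym -cards_eq0 cards1.
rewrite big1 ?addr0; last first.
  by move=> E /andP[/andP[]]; rewrite subset1 => /orP[] /eqP ->; rewrite eqxx.
by rewrite /bweight !big_set1 set11 inE.
Qed.

Lemma bexp_cst P (x : R) : bexp P (fun=> x) = x.
Proof.
move: {2}#|P| (erefl #|P|) => k; elim: k P => [|k IH] P cP.
  have /eqP -> : P == set0 by rewrite -cards_eq0 cP.
  rewrite /bexp (bigD1 set0) ?sub0set //= big1 ?addr0; last first.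
    by move=> E /andP[]; rewrite subset0 => ->.
  by rewrite /bweight big_set0 mul1r.
have /set0Pn[e eP] : P != set0 by rewrite -cards_eq0 cP.
have cPe : #|P :\ e| = k by move: cP; rewrite (cardsD1 e) eP => -[].
rewrite -(setD1K eP) bexp_split; last by rewrite disjoints1 !inE eqxx.
by rewrite bexp_set1 !(IH _ cPe) -mulrDl addrC subrK mul1r.
Qed.

Definition depends_on D f := forall E, f (E :&: D) = f E.

Lemma depends_onW D D' f : D \subset D' -> depends_on D f -> depends_on D' f.
Proof. by move=> /setIidPr sDD' fD E; rewrite -(fD (E :&: D')) -setIA sDD' fD. Qed.

Lemma disjointID P D : [disjoint P :&: D & P :\: D].
Proof.
by rewrite disjoints_subset; apply/subsetP => e; rewrite !inE => /andP[_ ->].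
Qed.

(** Drawing the elements of P in D1 first and the others afterwards, f only
sees the first draw and g only the second. *)
Lemma bexp_indep P D1 D2 f g : depends_on D1 f -> depends_on D2 g ->
  [disjoint D1 & D2] ->
  bexp P (fun E => f E * g E) = bexp P f * bexp P g.
Proof.
move=> fD1 gD2 dis.
suff fgE g' : depends_on D2 g' ->
    bexp P (fun E => f E * g' E) = bexp (P :&: D1) f * bexp (P :\: D1) g'.
  have := fgE (fun=> 1) (fun=> erefl); rewrite bexp_cst mulr1 => fE.
  rewrite fgE //; congr (_ * _); first by rewrite -fE; apply: eq_bexp => E _; rewrite mulr1.
  rewrite -[in RHS](setID P D1) bexp_split ?disjointID //.
  rewrite -[LHS](bexp_cst (P :&: D1)); apply: eq_bexp => E1 E1P.
  apply: eq_bexp => E2 E2P; rewrite -gD2 -[RHS]gD2; congr g.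
  rewrite setIUl [E1 :&: D2](_ : _ = set0) ?set0U //.
  apply/eqP; rewrite setI_eq0; apply: disjointWl dis.
  exact: subset_trans E1P (subsetIr _ _).
move=> gD2'; rewrite -[in LHS](setID P D1) bexp_split ?disjointID //.
rewrite -[RHS]mulrC -bexpZ; apply: eq_bexp => E1 E1P.
rewrite [RHS]mulrC -bexpZ; apply: eq_bexp => E2 E2P; congr (_ * _).
  rewrite -fD1 -[RHS]fD1; congr f.
  rewrite setIUl [E2 :&: D1](_ : _ = set0) ?setU0 //.
  apply/eqP; rewrite setI_eq0 disjoint_sym; apply: (disjointWr E2P).
  by rewrite disjoints_subset; apply/subsetP => e; rewrite !inE => ->.
rewrite -gD2' -[RHS]gD2'; congr g'.
rewrite setIUl [E1 :&: D2](_ : _ = set0) ?set0U //.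
apply/eqP; rewrite setI_eq0; apply: disjointWl dis.
exact: subset_trans E1P (subsetIr _ _).
Qed.

Lemma bexp_prod P (I : finType) (A : {set I}) (D : I -> {set T})
    (f : I -> {set T} -> R) :
  (forall i, i \in A -> depends_on (D i) (f i)) ->
  {in A &, forall i j, i != j -> [disjoint D i & D j]} ->
  bexp P (fun E => \prod_(i in A) f i E) = \prod_(i in A) bexp P (f i).
Proof.
move: {2}#|A| (erefl #|A|) => k; elim: k A => [|k IH] A cA fD dis.
  have /eqP -> : A == set0 by rewrite -cards_eq0 cA.
  rewrite big_set0 -[RHS](bexp_cst P); apply: eq_bexp => E _.
  by rewrite big_set0.
have /set0Pn[i iA] : A != set0 by rewrite -cards_eq0 cA.
have cAi : #|A :\ i| = k by move: cA; rewrite (cardsD1 i) iA => -[].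
rewrite (big_setD1 i iA) /= -IH //.
- rewrite -(@bexp_indep _ (D i) (\bigcup_(j in A :\ i) D j)).
  + by apply: eq_bexp => E _; rewrite (big_setD1 i iA).
  + exact: fD.
  + move=> E; apply: eq_bigr => j jA.
    apply: (@depends_onW (D j)); first exact: bigcup_sup.
    by apply: fD; case/setD1P: jA.
  + rewrite -setI_eq0 -subset0; apply/subsetP => e /setIP[eDi /bigcupP[j]].
    rewrite in_setD1 => /andP[ji jA] eDj.
    by move: (disjointFr (dis _ _ jA iA ji) eDj); rewrite eDi.
- by move=> j /setD1P[_]; exact: fD.
- by move=> j l /setD1P[_ jA] /setD1P[_ lA]; exact: dis.
Qed.

Hypothesis p01 : 0 <= p <= 1.

Lemma bweight_ge0 P E : 0 <= bweight P E.
Proof.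
case/andP: p01 => p0 p1; apply: prodr_ge0 => e _.
by case: ifP => // _; rewrite subr_ge0.
Qed.

Lemma le_bexp P f g : (forall E, E \subset P -> f E <= g E) -> bexp P f <= bexp P g.
Proof.
move=> fg; apply: ler_sum => E EP; apply: ler_wpM2l; first exact: bweight_ge0.
exact: fg.
Qed.

Definition bprob P (A : pred {set T}) : R := bexp P (fun E => (A E)%:R).

Lemma eq_bprob P (A B : pred {set T}) :
  (forall E, E \subset P -> A E = B E) -> bprob P A = bprob P B.
Proof. by move=> AB; apply: eq_bexp => E /AB ->. Qed.

Lemma le_bprob P (A B : pred {set T}) :
  (forall E, E \subset P -> A E -> B E) -> bprob P A <= bprob P B.
Proof.
move=> AB; apply: le_bexp => E /AB; case: (A E) => [->//|_].
exact: ler0n.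
Qed.

Lemma bprob_ge0 P A : 0 <= bprob P A.
Proof. by rewrite -(bexp_cst P 0); apply: le_bexp => E _; rewrite ler0n. Qed.

Lemma bprob_le1 P A : bprob P A <= 1.
Proof. by rewrite -(bexp_cst P 1); apply: le_bexp => E _; rewrite lern1 leq_b1. Qed.

Lemma bprobC P A : bprob P (fun E => ~~ A E) = 1 - bprob P A.
Proof.
rewrite -{1}(bexp_cst P 1) -bexpB; apply: eq_bexp => E _.
by case: (A E); rewrite ?subrr ?subr0.
Qed.

Lemma bprobU P (A B : pred {set T}) :
  bprob P (fun E => A E || B E) <= bprob P A + bprob P B.
Proof.
rewrite /bprob /bexp -big_split /=; apply: ler_sum => E _.
rewrite -mulrDr; apply: ler_wpM2l; first exact: bweight_ge0.
by case: (A E); case: (B E); rewrite /= ?addr0 ?add0r // lerDl.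
Qed.

Lemma bprob_exists P (I : finType) (Q : pred I) (A : I -> pred {set T}) :
  bprob P (fun E => [exists i, Q i && A i E]) <= \sum_(i | Q i) bprob P (A i).
Proof.
rewrite /bprob -bexp_sum; apply: le_bexp => E _.
case: existsP => [[i /andP[Qi Ai]]|_]; last by apply: sumr_ge0 => i _; exact: ler0n.
by rewrite (bigD1 i) //= Ai lerDl; apply: sumr_ge0 => j _; exact: ler0n.
Qed.

Definition event_on D (A : pred {set T}) := forall E, A (E :&: D) = A E.

Lemma bprob_forall P (I : finType) (J : {set I}) (D : I -> {set T})
    (A : I -> pred {set T}) :
  (forall i, i \in J -> event_on (D i) (A i)) ->
  {in J &, forall i j, i != j -> [disjoint D i & D j]} ->
  bprob P (fun E => [forall i in J, A i E]) = \prod_(i in J) bprob P (A i).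
Proof.
move=> AD dis; rewrite -(@bexp_prod P _ J D (fun i E => (A i E)%:R)) //; last first.
  by move=> i iJ E; rewrite AD.
apply: eq_bexp => E _; case: forall_inP => [AJ|nAJ].
  by rewrite big1 // => i /AJ ->.
have [i iJ nAi] : exists2 i, i \in J & ~~ A i E.
  by apply/exists_inP; rewrite -negb_forall_in; apply/forall_inP.
by rewrite (bigD1 i) //= (negPf nAi) mul0r.
Qed.

Lemma bprobI P D1 D2 (A B : pred {set T}) : event_on D1 A -> event_on D2 B ->
  [disjoint D1 & D2] ->
  bprob P (fun E => A E && B E) = bprob P A * bprob P B.
Proof.
move=> AD BD dis; rewrite -(@bexp_indep P D1 D2 (fun E => (A E)%:R) (fun E => (B E)%:R)) //.
- by apply: eq_bexp => E _; rewrite -natrM mulnb.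
- by move=> E; rewrite AD.
- by move=> E; rewrite BD.
Qed.

Lemma bprob_in P e : e \in P -> bprob P (fun E => e \in E) = p.
Proof.
move=> eP; rewrite /bprob -(setD1K eP) bexp_split; last by rewrite disjoints1 !inE eqxx.
rewrite bexp_set1.
rewrite (eq_bexp (g := fun=> 1)) => [|E _]; last by rewrite !inE eqxx.
rewrite [X in _ + _ * X](eq_bexp (g := fun=> 0)) => [|E /subsetP EP].
  by rewrite !bexp_cst mulr0 addr0 mulr1.
rewrite set0U; case: (boolP (e \in E)) => // /EP.
by rewrite !inE eqxx.
Qed.

End BinomialSubset.

(** * Monochromatic components and spanning trees *)

Section SpanningTree.
Variable T : finType.
Implicit Types (E F : {set {set T}}) (x y : T).

Lemma adj_sym F : symmetric (adj F).
Proof. by move=> x y; rewrite /adj setUC. Qed.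

Lemma connect_adj_sym F : connect_sym (adj F).
Proof. exact: sym_connect_sym (adj_sym F). Qed.

Lemma path_avoid (e : rel T) (A : pred T) x s y :
  path e x (rcons s y) -> all A (x :: s) ->
  path (fun u v => e u v && A u) x (rcons s y).
Proof.
elim: s x => [|z s IH] x /=; first by move=> /andP[-> _] /andP[->].
by move=> /andP[-> es] /andP[-> As] /=; exact: IH.
Qed.

(** The rest of the cycle replaces its first edge, so that a minimal edge set
connecting a component has no cycle. *)
Lemma connect_del_cycle F x y z s : ucycle (adj F) [:: x, y, z & s] ->
  forall u v, connect (adj F) u v -> connect (adj (F :\ [set x; y])) u v.
Proof.
move=> /andP[/= /and3P[Fxy Fyz Fz] /and3P[]].
rewrite !inE !negb_or => /and3P[xy xz xs] /andP[yz ys] uzs.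
have cyx : connect (adj (F :\ [set x; y])) y x.
  apply: (connect_trans (y := z)).
    apply: connect1; rewrite /adj in_setD1 -/(adj F y z) Fyz andbT.
    apply: contraNneq yz => /setP /(_ z); rewrite !inE eqxx orbT.
    by rewrite eq_sym (negPf xz) /= eq_sym => <-.
  apply: (@connect_sub _ (fun u v => adj F u v && ((u != x) && (u != y)))).
    move=> u v /andP[Fuv /andP[ux uy]]; apply: connect1.
    rewrite /adj in_setD1 -/(adj F u v) Fuv andbT.
    apply: contraNneq ux => /setP /(_ u); rewrite !inE eqxx /=.
    by rewrite (negPf uy) orbF => <-.
  apply/connectP; exists (rcons s x); last by rewrite last_rcons.
  apply: (path_avoid (A := fun u => (u != x) && (u != y))) => //=.
  rewrite eq_sym xz eq_sym yz /=; apply/allP => u us.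
  apply/andP; split; first by apply: contraNneq xs => <-.
  by apply: contraNneq ys => <-.
apply: connect_sub => u v Fuv.
have [e|ne] := eqVneq [set u; v] [set x; y]; last first.
  by apply: connect1; rewrite /adj in_setD1 ne.
have cxy : connect (adj (F :\ [set x; y])) x y by rewrite connect_adj_sym.
have : u \in [set x; y] by rewrite -e !inE eqxx.
have : v \in [set x; y] by rewrite -e !inE eqxx orbT.
by rewrite !inE => /orP[] /eqP -> /orP[] /eqP ->.
Qed.

Lemma spanning_tree F x :
  exists H : {set T} * {set {set T}},
    [/\ subgraph F H, tree H & H.1 = [set y | connect (adj F) x y]].
Proof.
pose V := [set y | connect (adj F) x y].
pose F0 := [set e in F | e \subset V].
pose P (F' : {set {set T}}) := (F' \subset F0) && [forall y in V, connect (adj F') x y].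
have PF0 : P F0.
  rewrite /P subxx; apply/forall_inP => y; rewrite inE => /connectP[s].
  elim/last_ind: s y => [|s z IH] y /=; first by move=> _ ->; exact: connect0.
  rewrite rcons_path last_rcons => /andP[Fs Fsz] ->.
  apply: (connect_trans (IH _ Fs erefl)); apply: connect1.
  have cs : connect (adj F) x (last x s) by apply/connectP; exists s.
  rewrite /adj inE -/(adj F _ _) Fsz; apply/subsetP => u; rewrite !inE.
  move=> /orP[] /eqP -> //; apply: connect_trans cs _; exact: connect1.
have [F' /minsetP[/andP[F'0 /forall_inP cF'] minF'] _] := minset_exists PF0.
exists (V, F'); split => //; first split => /=.
- by apply: subset_trans F'0 _; apply/subsetP => e; rewrite inE => /andP[].
- by move=> e /(subsetP F'0); rewrite inE => /andP[].
- split => /=; first by apply/set0Pn; exists x; rewrite inE connect0.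
    move=> y z yV zV; apply: connect_trans (cF' z zV).
    by rewrite connect_adj_sym cF'.
  case=> [|y [|z [|w s]]] // _ cyc.
  suff PF1 : P (F' :\ [set y; z]).
    have := minF' _ PF1 (subD1set _ _) => /setP /(_ [set y; z]).
    by rewrite !inE eqxx /=; case/andP: cyc => /andP[]; rewrite /adj => ->.
  apply/andP; split; first by apply: subset_trans F'0; exact: subD1set.
  by apply/forall_inP => u uV; apply: connect_del_cycle cyc _ _ _; exact: cF'.
Qed.

Variable r : nat.
Implicit Types col : {set T} -> 'I_r.

Definition colour_class E col (c : 'I_r) : {set {set T}} :=
  [set e in E | col e == c].

Lemma tc_leP E m : tree_coverable r E m -> (tc r E <= m)%N.
Proof. by move=> cE; rewrite /tc; case: ex_minnP => k _; apply; apply/asboolP. Qed.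

Lemma tc_coverable E : tree_coverable r E (tc r E).
Proof. by rewrite /tc; case: ex_minnP => k /asboolP. Qed.

(** Spanning trees of components may be used in place of the components, which
are here given by a colour and a vertex. *)
Lemma tree_coverable_components E m :
  (forall col, exists2 K : {set 'I_r * T}, (#|K| <= m)%N &
     forall v, exists2 k, k \in K & connect (adj (colour_class E col k.1)) k.2 v) ->
  tree_coverable r E m.
Proof.
move=> cov col; have [K Km covK] := cov col.
have /choice[h hP] (k : 'I_r * T) := spanning_tree (colour_class E col k.1) k.2.
exists [set h k | k in K]; split.
- exact: leq_trans (leq_imset_card _ _) Km.
- move=> _ /imsetP[k kK ->]; have [[hE hin] th hV] := hP k.
  split => //.
    split => //; apply: subset_trans hE _.
    by apply/subsetP => e; rewrite inE => /andP[].
  move=> e f /(subsetP hE); rewrite inE => /andP[_ /eqP ->].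
  by move=> /(subsetP hE); rewrite inE => /andP[_ /eqP ->].
- apply/setP => v; rewrite inE; have [k kK kv] := covK v.
  apply/bigcupP; exists (h k); first exact: imset_f.
  by have [_ _ ->] := hP k; rewrite inE.
Qed.

End SpanningTree.

(** * Graphs with expansion have small tree covers *)

Lemma leq_card_bigcup (I T : finType) (P : pred I) (F : I -> {set T}) :
  (#|\bigcup_(i | P i) F i| <= \sum_(i | P i) #|F i|)%N.
Proof.
elim/big_rec2: _ => [|i k A _ IH]; first by rewrite cards0.
by rewrite (leq_trans (leq_card_setU _ _)) // leq_add2l.
Qed.

Lemma extract_subset (T : finType) (A : {set T}) k : (k <= #|A|)%N ->
  exists2 B : {set T}, B \subset A & #|B| = k.
Proof.
move=> /card_geqP[s [us <- sA]]; exists [set x in s].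
  by apply/subsetP => x; rewrite inE => /sA.
by rewrite cardsE; apply/card_uniqP.
Qed.

Section Upper.
Variables (T : finType) (r : nat).
Local Open Scope nat_scope.
Implicit Types (E : {set {set T}}) (A B U W : {set T}).

(** In the random graph of density p this holds for a about 4 / p. *)
Definition well_joined a E : bool :=
  [forall A : {set T}, forall B : {set T},
     [&& #|A| == a, #|T| <= 2 * #|B| & [disjoint A & B]] ==>
     [exists x in A, exists y in B, adj E x y]].

Definition joint_nbhd E U W : {set T} :=
  [set z | [forall u in U, adj E z u] && [exists w in W, adj E z w]].

(** Smaller sets W, for which well_joined says nothing, are enlarged by a
factor L when passing to the common neighbours of some k vertices with W. *)
Definition expanding a k L E : bool :=
  [forall U : {set T}, forall W : {set T},
     [&& #|U| == k, 0 < #|W| <= a & [disjoint U & W]] ==>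
     (L * #|W| < #|joint_nbhd E U W|)].

Section Colouring.
Variables (E : {set {set T}}) (col : {set T} -> 'I_r).
Hypothesis r_gt0 : 0 < r.

Let cc c x y := connect (adj (colour_class E col c)) x y.

Let cc_sym c x y : cc c x y = cc c y x.
Proof. exact: connect_adj_sym. Qed.

Let cc_edge x y : adj E x y -> cc (col [set x; y]) x y.
Proof. by move=> Exy; apply: connect1; rewrite /adj inE -/(adj E x y) Exy eqxx. Qed.

Definition touch x y := [exists c, cc c x y].

(** A largest cell is either so large that well_joined finds an edge leaving
all of its components, or so small that by expansion its vertices have, jointly
with r.-1 vertices v i, too many common neighbours to fit into all cells. *)
Lemma no_small_matching (a : nat) (v : 'I_(2 * r) -> T) :
  well_joined a E -> expanding a r.-1 ((2 * r) ^ r) E ->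
  (forall i j, touch (v i) (v j) -> i = j) ->
  (forall i c, 2 * r * #|[set y | cc c (v i) y]| < #|T|) ->
  False.
Proof.
move=> joinE expE vdis vsmall.
have two_r : 0 < 2 * r by lia.
pose cell (s : {ffun 'I_r -> 'I_(2 * r)}) := [set x | [forall c, cc c (v (s c)) x]].
have cellP s x : x \in cell s -> forall c, cc c (v (s c)) x by rewrite inE => /forallP.
pose i0 : 'I_(2 * r) := Ordinal two_r.
pose s0 : {ffun 'I_r -> 'I_(2 * r)} := [ffun=> i0].
have [s _ smax] := @arg_maxnP _ s0 predT (fun s => #|cell s|) isT.
set W := cell s in smax *.
have W_gt0 : 0 < #|W|.
  apply: leq_trans (smax s0 isT); apply/card_gt0P; exists (v i0).
  by rewrite inE; apply/forallP => c; rewrite ffunE; exact: connect0.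
pose c0 : 'I_r := Ordinal r_gt0.
have [aW|Wa] := leqP a #|W|.
  (* B misses r components of fewer than #|T| / (2 r) vertices each. *)
  pose B := [set b | [forall c, ~~ cc c (v (s c)) b]].
  have [A AW cA] := extract_subset aW.
  have BT : #|T| <= 2 * #|B|.
    have : r * (2 * #|~: B|) <= r * #|T|.
      have sub : ~: B \subset \bigcup_(c : 'I_r) [set y | cc c (v (s c)) y].
        apply/subsetP => b; rewrite !inE negb_forall => /existsP[c].
        by rewrite negbK => vb; apply/bigcupP; exists c; rewrite // inE.
      have := leq_trans (subset_leq_card sub) (leq_card_bigcup _ _).
      rewrite mulnCA mulnA => le1.
      apply: leq_trans (_ : \sum_(c < r) #|T| <= _); last first.
        by rewrite sum_nat_const card_ord.
      apply: leq_trans (_ : 2 * r * \sum_(c < r) #|[set y | cc c (v (s c)) y]| <= _).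
        by rewrite leq_mul2l le1 orbT.
      by rewrite big_distrr /=; apply: leq_sum => c _; exact: ltnW.
    rewrite leq_pmul2l //; have := cardsC B; lia.
  have dAB : [disjoint A & B].
    rewrite disjoints_subset; apply: subset_trans AW _.
    apply/subsetP => x /cellP /(_ c0) vx; rewrite !inE negb_forall.
    by apply/existsP; exists c0; rewrite negbK.
  move/forallP: joinE => /(_ A) /forallP /(_ B).
  rewrite cA eqxx BT dAB /= => /exists_inP[x xA /exists_inP[y yB Exy]].
  move: yB; rewrite inE => /forallP /(_ (col [set x; y])) /negP; apply.
  apply: connect_trans (cc_edge Exy); exact: (cellP s x (subsetP AW x xA)).
(* W is too small for well_joined; U is taken from the indices that s omits. *)
pose J := ~: [set s c | c in 'I_r].
have cJ : r.-1 <= #|J|.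
  have := cardsC [set s c | c in 'I_r]; rewrite -/J card_ord.
  have : #|[set s c | c in 'I_r]| <= r.
    by rewrite (leq_trans (leq_imset_card _ _)) // card_ord.
  lia.
have /card_geqP[us [uus sus susJ]] := cJ.
pose J' := [set j in us].
have cJ' : #|J'| = r.-1 by rewrite cardsE -sus; apply/card_uniqP.
have J's j c : j \in J' -> s c <> j.
  by rewrite inE => /susJ; rewrite inE => /negP nj e; apply: nj; rewrite -e imset_f.
have vinj : injective v.
  by move=> i j e; apply: vdis; apply/existsP; exists c0; rewrite e; exact: connect0.
pose U := [set v j | j in J'].
have cU : #|U| = r.-1 by rewrite card_imset.
have dUW : [disjoint U & W].
  rewrite disjoints_subset; apply/subsetP => _ /imsetP[j jJ ->].
  rewrite inE; apply/negP => /cellP /(_ c0) vv.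
  by apply: (J's j c0 jJ); apply: vdis; apply/existsP; exists c0.
move/forallP: expE => /(_ U) /forallP /(_ W).
rewrite cU eqxx W_gt0 (ltnW Wa) dUW /=; apply/negP; rewrite -leqNgt.
have sub : joint_nbhd E U W \subset \bigcup_(s' : {ffun 'I_r -> 'I_(2 * r)}) cell s'.
  apply/subsetP => z; rewrite inE => /andP[/forall_inP zU /exists_inP[y yW zy]].
  pose g j := col [set z; v j].
  have gP j : j \in J' -> cc (g j) z (v j).
    by move=> jJ; apply: cc_edge; apply: zU; exact: imset_f.
  have ginj : {in J' &, injective g}.
    move=> i j iJ jJ gij; apply: vdis; apply/existsP; exists (g i).
    apply: (connect_trans (y := z)); last by rewrite gij; exact: gP.
    by rewrite -/(cc (g i) (v i) z) cc_sym gP.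
  pose d := col [set z; y].
  have dzy : cc d z y by exact: cc_edge.
  have dg : d \notin [set g j | j in J'].
    apply/imsetP => -[j jJ e]; apply: (J's j d jJ).
    apply: vdis; apply/existsP; exists d.
    apply: (connect_trans (cellP _ _ yW d)); apply: (connect_trans (y := z)).
      by rewrite -/(cc d y z) cc_sym.
    by rewrite e; exact: gP.
  (* The colours from z to the r - 1 vertices of U and to y exhaust all r. *)
  have full : d |: [set g j | j in J'] = setT.
    apply/eqP; rewrite eqEcard subsetT cardsT card_ord cardsU1 dg.
    rewrite card_in_imset // cJ'; lia.
  have /choice[s' s'P] (c : 'I_r) : exists i, cc c (v i) z.
    have : c \in d |: [set g j | j in J'] by rewrite full.
    rewrite in_setU1 => /orP[/eqP -> | /imsetP[j jJ ->]].
      exists (s d); apply: (connect_trans (cellP _ _ yW d)).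
      by rewrite -/(cc d y z) cc_sym.
    by exists j; rewrite cc_sym gP.
  apply/bigcupP; exists [ffun c => s' c] => //.
  by rewrite inE; apply/forallP => c; rewrite ffunE.
apply: leq_trans (subset_leq_card sub) _.
apply: leq_trans (leq_card_bigcup _ _) _.
apply: leq_trans (_ : \sum_(s' : {ffun 'I_r -> 'I_(2 * r)}) #|W| <= _).
  by apply: leq_sum => s' _; exact: smax.
by rewrite sum_nat_const card_ffun !card_ord.
Qed.

(** The cover consists of the big components and of all components of a
maximal set of vertices, outside the big components, no two of which share a
component. Each part contributes at most twice the square of r. *)
Lemma cover_by_components (a : nat) : 0 < #|T| ->
  well_joined a E -> expanding a r.-1 ((2 * r) ^ r) E ->
  exists2 K : {set 'I_r * T}, #|K| <= 4 * r ^ 2 &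
    forall v, exists2 k, k \in K & cc k.1 k.2 v.
Proof.
move=> T_gt0 joinE expE.
pose comp c x := [set y | cc c x y].
pose big c x := #|T| <= 2 * r * #|comp c x|.
pose rt c x := fingraph.root (adj (colour_class E col c)) x.
have rtP c x : cc c x (rt c x) by exact: connect_root.
have rt_eq c x y : cc c x y -> rt c x = rt c y.
  by move=> xy; apply/eqP; rewrite fingraph.root_connect //; exact: connect_adj_sym.
have comp_eq c x y : cc c x y -> comp c x = comp c y.
  move=> xy; apply/setP => z; rewrite !inE.
  by apply: same_connect xy _; exact: connect_adj_sym.
pose Kbig := [set k : 'I_r * T | big k.1 k.2 && (rt k.1 k.2 == k.2)].
pose M0 A := [forall x in A, forall c, ~~ big c x] &&
             [forall x in A, forall y in A, touch x y ==> (x == y)].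
have M00 : M0 set0.
  by apply/andP; split; apply/forall_inP => x; rewrite inE.
have [M maxM _] := maxset_exists M00.
case/maxsetP: maxM => /andP[/forall_inP Mbig /forall_inP Mdis] maxM.
have Mtouch x y : x \in M -> y \in M -> touch x y -> x = y.
  by move=> xM yM; move/forall_inP: (Mdis x xM) => /(_ y yM) /implyP h /h /eqP.
have cM : #|M| < 2 * r.
  rewrite ltnNge; apply/negP => cM.
  have [M' M'M cM'] := extract_subset cM.
  pose v (i : 'I_(2 * r)) : T := enum_val (cast_ord (esym cM') i).
  have vM i : v i \in M by apply: (subsetP M'M); exact: enum_valP.
  apply: (@no_small_matching a v) => //.
    move=> i j tij; have /enum_val_inj/cast_ord_inj // := Mtouch _ _ (vM i) (vM j) tij.
  by move=> i c; rewrite ltnNge; move/forallP: (Mbig _ (vM i)) => /(_ c).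
have cKbig : #|Kbig| <= 2 * r ^ 2.
  have bc c : #|[set x | big c x && (rt c x == x)]| <= 2 * r.
    set S := [set x | _].
    rewrite -(leq_pmul2r T_gt0).
    apply: leq_trans (_ : \sum_(x in S) 2 * r * #|comp c x| <= _).
      rewrite -sum_nat_const; apply: leq_sum => x; rewrite inE => /andP[bx _].
      exact: bx.
    rewrite -big_distrr /= leq_mul2l; apply/orP; right.
    have compE x : x \in S -> #|comp c x| = \sum_(y : T) (rt c y == x).
      rewrite inE => /andP[_ /eqP rx].
      rewrite -sum1_card big_mkcond /=; apply: eq_bigr => y _; rewrite inE.
      have [xy|nxy] := boolP (cc c x y); first by rewrite -(rt_eq _ _ _ xy) rx eqxx.
      by case: eqP => // e; case/negP: nxy; rewrite -e cc_sym.
    rewrite (eq_bigr _ compE) exchange_big /= -sum1_card.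
    apply: leq_sum => y _.
    have [yS|yS] := boolP (rt c y \in S); last first.
      rewrite big1 // => x xS; case: eqP => // e.
      by move: yS; rewrite e xS.
    rewrite (bigD1 (rt c y)) //= eqxx big1 // => x /andP[_].
    by rewrite eq_sym => /negPf ->.
  have -> : Kbig = \bigcup_(c : 'I_r) [set (c, x) | x in [set x | big c x && (rt c x == x)]].
    apply/setP => -[c x]; rewrite inE /=; apply/idP/bigcupP => [h|[c' _ /imsetP[y]]].
      by exists c => //; apply: imset_f; rewrite inE.
    by rewrite inE => h [-> ->].
  apply: leq_trans (leq_card_bigcup _ _) _.
  apply: leq_trans (_ : \sum_(c < r) 2 * r <= _); last first.
    by rewrite sum_nat_const card_ord; lia.
  by apply: leq_sum => c _; exact: leq_trans (leq_imset_card _ _) (bc c).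
exists (Kbig :|: setX setT M).
  apply: leq_trans (leq_card_setU _ _) _.
  rewrite cardsX cardsT card_ord (_ : 4 * r ^ 2 = 2 * r ^ 2 + r * (2 * r)); last by lia.
  by apply: leq_add; rewrite // leq_mul2l ltnW ?orbT.
move=> v; have [/existsP[c bv]|nbig] := boolP [exists c, big c v].
  exists (c, rt c v); last by rewrite /= cc_sym.
  rewrite !inE /= {1}/big -(comp_eq _ _ _ (rtP c v)) [_ <= _]bv /=.
  by rewrite -(rt_eq _ _ _ (rtP c v)) eqxx.
have [vM|vM] := boolP (v \in M).
  exists (Ordinal r_gt0, v); last exact: connect0.
  by rewrite !inE /= vM orbT.
suff [x xM /existsP[c cxv]] : exists2 x, x \in M & touch x v.
  by exists (c, x) => //; rewrite !inE /= xM orbT.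
apply/exists_inP; apply: contraNT vM => /exists_inPn nt.
rewrite -(maxM (v |: M)); first by rewrite setU11.
  rewrite negb_exists in nbig.
  apply/andP; split.
    by apply/forall_inP => x; rewrite in_setU1 => /orP[/eqP ->|/Mbig].
  apply/forall_inP => x; rewrite in_setU1 => xvM.
  apply/forall_inP => y; rewrite in_setU1 => yvM; apply/implyP => txy.
  case/orP: xvM yvM => [/eqP ex|xM] /orP[/eqP ey|yM]; first by rewrite ex ey.
  - case/negP: (nt y yM); case/existsP: txy => c cxy.
    by apply/existsP; exists c; rewrite cc_sym -ex.
  - by case/negP: (nt x xM); rewrite -ey.
  - by apply/eqP; exact: Mtouch.
exact: subsetUr.
Qed.

End Colouring.

Lemma tc_upper a E : 0 < r -> 0 < #|T| ->
  well_joined a E -> expanding a r.-1 ((2 * r) ^ r) E -> tc r E <= 4 * r ^ 2.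
Proof.
move=> r0 T0 joinE expE; apply/tc_leP/tree_coverable_components => col.
exact: cover_by_components joinE expE.
Qed.
End Upper.

(** * Partial transversals *)

Section Transversal.
Local Open Scope nat_scope.
Variables (X : finType) (b : nat).
Implicit Types (f : {ffun X -> option 'I_b}) (t : {ffun X -> 'I_b}).

Definition dom f : {set X} := [set x | f x != None].

Definition hit f t (A : {set X}) := [exists x in A, f x == Some (t x)].

(** Greedy choice: each function in turn uses up one new point of B. *)
Lemma patch_transversal (s : seq {ffun X -> option 'I_b}) (B : {set X}) t :
  (forall f, f \in s -> size s <= #|dom f :&: B|) ->
  exists t', (forall x, x \notin B -> t' x = t x) /\ forall f, f \in s -> hit f t' B.
Proof.
elim: s B t => [|f s IH] B t big; first by exists t.
have : 0 < #|dom f :&: B| by apply: leq_trans (big f _); rewrite ?mem_head.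
case/card_gt0P => x; rewrite !inE => /andP[fx xB].
case fxv: (f x) fx => [v|] // _.
pose t1 := [ffun y => if y == x then v else t y].
have [|t' [t't1 t's]] := IH (B :\ x) t1.
  move=> g gs; have := big g; rewrite inE gs orbT => /(_ isT) /=.
  by rewrite setIDA (cardsD1 x (_ :&: _)); case: (_ \in _) => /= *; lia.
exists t'; split=> [y yB|g].
  rewrite t't1; first by rewrite ffunE; case: eqP => // e; rewrite e xB in yB.
  by rewrite !inE (negPf yB) andbF.
rewrite inE => /orP[/eqP ->|/t's /exists_inP[y]].
  apply/exists_inP; exists x => //; rewrite fxv t't1 ?ffunE ?eqxx //.
  by rewrite !inE eqxx.
by rewrite inE => /andP[_ yB] hy; apply/exists_inP; exists y.
Qed.

(** At every point of A where f is defined, one value out of b is forbidden. *)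
Lemma card_miss f (A : {set X}) q : q <= #|dom f :&: A| ->
  #|[set t | ~~ hit f t A]| <= b.-1 ^ q * b ^ (#|X| - q).
Proof.
move=> qA.
pose Q x : pred 'I_b :=
  [pred v | if x \in A then f x != Some v else true].
have -> : #|[set t | ~~ hit f t A]| = #|(family Q : pred {ffun X -> 'I_b})|.
  apply: eq_card => t; rewrite inE; apply/idP/familyP => [nh x|tQ].
    rewrite !inE; case: ifP => // xA; apply: contraNneq nh => fx.
    by apply/exists_inP; exists x; rewrite ?fx.
  by apply/exists_inPn => x xA; have := tQ x; rewrite !inE xA.
rewrite card_family foldrE big_map big_enum /=.
have cQ x : #|Q x| = if x \in dom f :&: A then b.-1 else b.
  rewrite !inE; case fx: (f x) => [v|] /=; last first.
    transitivity #|'I_b|; last exact: card_ord.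
    by apply: eq_card => v; rewrite !inE fx; case: ifP.
  case: ifP => xA.
    transitivity #|predC1 v|; last by rewrite cardC1 card_ord.
    apply: eq_card => u; rewrite !inE xA fx.
    by congr (~~ _); apply/eqP/eqP => [[->]|->].
  transitivity #|'I_b|; last exact: card_ord.
  by apply: eq_card => u; rewrite !inE xA.
under eq_bigr do rewrite cQ.
rewrite (bigID (mem (dom f :&: A))) /=.
rewrite (eq_bigr (fun=> b.-1)) => [|x ->//].
rewrite [X in _ * X](eq_bigr (fun=> b)) => [|x /negPf ->//].
rewrite !big_const !iter_muln_1.
rewrite (_ : #|[pred x | x \notin _]| = #|X| - #|dom f :&: A|); last first.
  by rewrite -(cardC (mem (dom f :&: A))) addKn; apply: eq_card => x; rewrite !inE.
rewrite -[#|[pred x in dom f :&: A]|]/(#|dom f :&: A|).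
set d := #|dom f :&: A| in qA *; have dX : d <= #|X| by exact: max_card.
rewrite -{1}(subnKC qA) expnD -mulnA leq_mul2l; apply/orP; right.
rewrite (_ : #|X| - q = (d - q) + (#|X| - d)); last by lia.
rewrite expnD leq_mul2r; apply/orP; right.
by case: (d - q) => // ?; rewrite leq_exp2r // leq_pred.
Qed.

(** By card_miss, the number of functions of F that a uniformly random t
misses on A is on average at most q. *)
Lemma random_transversal (F : {set {ffun X -> option 'I_b}}) (A : {set X}) q :
  0 < b -> #|F| * b.-1 ^ q <= q * b ^ q ->
  (forall f, f \in F -> q <= #|dom f :&: A|) ->
  q <= #|X| ->
  exists t, #|[set f in F | ~~ hit f t A]| <= q.
Proof.
move=> b0 Fq FA qX.
suff /existsP[t] : [exists t, #|[set f in F | ~~ hit f t A]| <= q] by exists t.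
apply: contraT => /existsPn big.
have : \sum_(t : {ffun X -> 'I_b}) q.+1 <= \sum_t #|[set f in F | ~~ hit f t A]|.
  by apply: leq_sum => t _; rewrite ltnNge big.
rewrite sum_nat_const card_ffun card_ord leqNgt => /negP[].
have -> : \sum_t #|[set f in F | ~~ hit f t A]| = \sum_(f in F) #|[set t | ~~ hit f t A]|.
  have cnt1 t : #|[set f in F | ~~ hit f t A]| = \sum_(f in F) ~~ hit f t A.
    rewrite -sum1_card [RHS]big_mkcond [LHS]big_mkcond /=; apply: eq_bigr => f _.
    by rewrite inE; case: (f \in F) => //=; case: hit.
  have cnt2 f : #|[set t | ~~ hit f t A]| = \sum_t ~~ hit f t A.
    rewrite -sum1_card big_mkcond /=; apply: eq_bigr => t _.
    by rewrite inE; case: hit.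
  by under eq_bigr do rewrite cnt1; under [RHS]eq_bigr do rewrite cnt2; exact: exchange_big.
apply: leq_ltn_trans (_ : \sum_(f in F) b.-1 ^ q * b ^ (#|X| - q) < _).
  by apply: leq_sum => f fF; apply: card_miss; exact: FA.
rewrite sum_nat_const mulnA; apply: leq_ltn_trans (_ : q * b ^ q * b ^ (#|X| - q) < _).
  by rewrite leq_mul2r Fq orbT.
by rewrite -mulnA -expnD subnKC // mulnC ltn_pmul2l // expn_gt0 b0.
Qed.

(** A random choice on A leaves at most q functions, few enough to be hit one
by one on the complement of A. *)
Lemma exists_transversal (F : {set {ffun X -> option 'I_b}}) (A : {set X}) q :
  0 < b -> #|F| * b.-1 ^ q <= q * b ^ q ->
  (forall f, f \in F -> q <= #|dom f :&: A| /\ q <= #|dom f :&: ~: A|) ->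
  q <= #|X| ->
  exists t, forall f, f \in F -> exists x, f x = Some (t x).
Proof.
move=> b0 Fq FA qX.
have [f /FA[]//|t tF] := random_transversal b0 Fq _ qX (A := A).
have [|t' [t't hit']] := @patch_transversal (enum [set f in F | ~~ hit f t A]) (~: A) t.
  move=> f; rewrite mem_enum -cardE inE => /andP[/FA[_ fA] _].
  exact: leq_trans fA.
exists t' => f fF.
have [/exists_inP[x xA /eqP fx]|nh] := boolP (hit f t A).
  by exists x; rewrite t't // inE xA.
have /hit'/exists_inP[x _ /eqP fx] : f \in enum [set f in F | ~~ hit f t A].
  by rewrite mem_enum inE fF.
by exists x.
Qed.

(** A point at which no value avoids P accounts for b elements of P. *)
Lemma avoiding_partial (P : {set X * 'I_b}) q : #|P| < q.+1 * b ->
  exists f, #|~: dom f| <= q /\ forall x v, f x = Some v -> (x, v) \notin P.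
Proof.
move=> Pq; exists [ffun x => [pick v | (x, v) \notin P]]; split; last first.
  by move=> x v; rewrite ffunE; case: pickP => // u uP [<-].
rewrite -ltnS; have b0 : 0 < b by lia.
rewrite -(ltn_pmul2r b0); apply: leq_ltn_trans Pq.
set f := finfun _; have -> : #|~: dom f| * b = #|setX (~: dom f) [set: 'I_b]|.
  by rewrite cardsX cardsT card_ord.
apply: subset_leq_card.
apply/subsetP => -[x v]; rewrite !inE ffunE /=; case: pickP => // nP _.
by have /negbFE := nP v.
Qed.

End Transversal.

(** The ratio (b / b.-1) ^ b is at least 2, whence (b / b.-1) ^ q is at least
2 ^ K and so exceeds K. *)
Lemma expn_pred_bound (b q K : nat) :
  (0 < b -> K * b <= q -> K * b.-1 ^ q <= b ^ q)%N.
Proof.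
move=> b0 Kq.
have two : (2 * b.-1 ^ b <= b ^ b)%N.
  case: b b0 {Kq} => // b _; rewrite [b.+1.-1]/=.
  have bernoulli n : (b ^ n.+1 + n.+1 * b ^ n <= b.+1 ^ n.+1)%N.
    elim: n => [|n IH]; first by rewrite !expn1 expn0; lia.
    rewrite (expnS b.+1); apply: leq_trans (leq_mul (leqnn b.+1) IH).
    by rewrite !(expnS b); nia.
  by apply: leq_trans (bernoulli b); rewrite !(expnS b); nia.
have Kb : (K * b.-1 ^ (K * b) <= b ^ (K * b))%N.
  apply: (@leq_trans (2 ^ K * b.-1 ^ (K * b))).
    by rewrite leq_mul2r (ltnW (ltn_expl _ _)) // orbT.
  rewrite (mulnC K) !expnM -expnMn.
  by case: K {Kq} => // K; rewrite leq_exp2r.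
rewrite -(subnKC Kq) !expnD mulnA; apply: leq_mul => //.
by case: (q - _)%N => // ?; rewrite leq_exp2r // leq_pred.
Qed.

(** * A colouring that needs many trees *)

Section Lower.
Local Open Scope nat_scope.
Variables (T : finType) (r q b : nat) (E : {set {set T}}).
Let F := {ffun 'I_(4 * q) -> option 'I_b}.
Variable phi : F -> T.

Definition partial_transversals : {set F} := [set f | #|~: dom f| <= q].
Let J := partial_transversals.

Hypotheses (q_gt0 : 0 < q) (b_gt0 : 0 < b) (qr : 4 * q < r).
Hypothesis E_pairs : E \subset pairs T.
Hypothesis phi_inj : injective phi.
Hypothesis phi_indep : forall f g : F, ~~ adj E (phi f) (phi g).
Hypothesis phi_nbrs : forall w, #|[set f | adj E w (phi f)]| * b.-1 ^ q <= q * b ^ q.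

Let front : {set 'I_(4 * q)} := [set x : 'I_(4 * q) | x < 2 * q].

Let front_card : #|front| = 2 * q /\ #|~: front| = 2 * q.
Proof.
have le : 2 * q <= 4 * q by lia.
have c1 : #|front| = 2 * q.
  have winj : injective (widen_ord le) by move=> x y /(congr1 val) /= /val_inj.
  rewrite -[RHS]card_ord -cardsT -(card_imset _ winj).
  apply: eq_card => x; rewrite inE; apply/idP/imsetP => [x2|[y _ ->]]; last exact: (ltn_ord y).
  by exists (Ordinal x2) => //; apply: val_inj.
by split=> //; have := cardsC front; rewrite card_ord c1; lia.
Qed.

Let transversal_at w : exists t : {ffun 'I_(4 * q) -> 'I_b},
  forall f, f \in J -> adj E w (phi f) -> exists x, f x = Some (t x).
Proof.
have [cA cA'] := front_card.
have [|f||t tP] := @exists_transversal _ _ [set f in J | adj E w (phi f)] front q b_gt0.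
- apply: leq_trans (phi_nbrs w); rewrite leq_mul2r; apply/orP; right.
  by apply: subset_leq_card; apply/subsetP => f; rewrite !inE => /andP[].
- rewrite !inE => /andP[df _].
  have hA (A : {set 'I_(4 * q)}) : #|A| = 2 * q -> q <= #|dom f :&: A|.
    move=> cA2; have := cardsID A (~: dom f); have := cardsID (dom f) A.
    have -> : A :\: dom f = ~: dom f :&: A by rewrite setDE setIC.
    rewrite (setIC A) cA2 => e1 e2.
    have le : #|~: dom f :&: A| <= q by apply: leq_trans df; rewrite -e2 leq_addr.
    by rewrite -(leq_add2r #|~: dom f :&: A|) e1 mul2n -addnn leq_add2l.
  by split; exact: hA.
- by rewrite card_ord; lia.
by exists t => f fJ wf; apply: tP; rewrite inE fJ.
Qed.

(** An edge at phi f gets as colour a block x in which f meets the full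
transversal t w of its other end w. Labelling phi f by f x and w by t w x, the
label is constant along the edges of colour x, hence on every tree of that
colour. *)
Lemma exists_bad_colouring :
  exists col : {set T} -> 'I_r,
  forall H, mono_tree E col H ->
  exists xv : 'I_(4 * q) * 'I_b,
    forall f, f \in J -> phi f \in H.1 -> f xv.1 = Some xv.2.
Proof.
have /choice[t tP] := transversal_at.
(* The label of u in colour x names the component of u: it is the point of the
   partial transversal f in block x if u = phi f, and that of t u otherwise. *)
pose lab u x := if [pick f in J | phi f == u] is Some f then f x else Some (t u x).
have lab_phi f x : f \in J -> lab (phi f) x = f x.
  move=> fJ; rewrite /lab; case: pickP => [g /andP[_ /eqP /phi_inj ->] //|/(_ f)].
  by rewrite /= fJ eqxx.
have lab_out u x : (forall f, f \in J -> phi f != u) -> lab u x = Some (t u x).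
  by move=> uJ; rewrite /lab; case: pickP => // f /andP[/uJ /negPf ->].
have last_ord : r.-1 < r by lia.
pose good (e : {set T}) x := [exists f in J, phi f \in e] &&
  [exists v, [forall u in e, lab u x == Some v]].
pose col (e : {set T}) : 'I_r :=
  if [pick x | good e x] is Some x then widen_ord (ltnW qr) x
  else Ordinal last_ord.
have colW e x : col e = widen_ord (ltnW qr) x ->
    exists v, forall u, u \in e -> lab u x = Some v.
  rewrite /col; case: pickP => [y /andP[_ /existsP[v /forall_inP vP]]|_ /(congr1 val) /=].
    move=> /(congr1 val) /= /val_inj <-; exists v => u /vP /eqP //.
  by move=> e1; have := ltn_ord x; lia.
have edge_col e f : e \in E -> f \in J -> phi f \in e ->
    exists x, col e = widen_ord (ltnW qr) x.
  move=> eE fJ fe; suff [x gx] : exists x, good e x.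
    by rewrite /col; case: pickP => [y _|/(_ x)]; [exists y | rewrite gx].
  have := subsetP E_pairs _ eE; rewrite inE => /cards2P[y [z [yz ee]]].
  have [w we] : exists w, e = [set w; phi f].
    move: fe; rewrite ee !inE => /orP[] /eqP ->; last by exists y.
    by exists z; rewrite setUC.
  have wf : adj E w (phi f) by rewrite /adj -we.
  have [x fx] := tP w f fJ wf; exists x; apply/andP; split.
    by apply/exists_inP; exists f.
  apply/existsP; exists (t w x); apply/forall_inP => u; rewrite we !inE.
  move=> /orP[] /eqP ->; last by rewrite lab_phi // fx.
  rewrite lab_out // => g gJ; apply: contraNneq (phi_indep g f) => ->.
  exact: wf.
exists col => -[V H] [[/= HE HV] [/= V0 conV _] Hmono].
have [|nof] := pickP [pred f in J | phi f \in V]; last first.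
  have x0 : 0 < 4 * q by lia.
  exists (Ordinal x0, Ordinal b_gt0) => f fJ fV /=.
  by have := nof f; rewrite /= fJ fV.
move=> f0 /andP[fJ fV].
have [|noe] := pickP [pred e in H | phi f0 \in e].
  move=> e /andP[eH fe].
  have [x cx] := edge_col e f0 (subsetP HE _ eH) fJ fe.
  have lab_edge u v : adj H u v -> lab u x = lab v x.
    move=> uvH; have [|w wP] := colW [set u; v] x.
      by rewrite -cx; apply: Hmono.
    by rewrite !wP // !inE eqxx ?orbT.
  have lab_conn u v : connect (adj H) u v -> lab u x = lab v x.
    move=> /connectP[s]; elim: s u => [|w s IH] u /=; first by move=> _ ->.
    by move=> /andP[/lab_edge -> /IH h] /h.
  have [v vP] := colW _ _ cx.
  exists (x, v) => f fJ' fV' /=.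
  by rewrite -lab_phi // (lab_conn _ (phi f0)) ?conV // vP.
have [x] : exists x, f0 x != None.
  apply/existsP; apply: contraT => /existsPn nd.
  move: fJ; rewrite inE (_ : ~: dom f0 = setT); last first.
    by apply/setP => x; rewrite !inE nd.
  by rewrite cardsT card_ord; lia.
case fx: (f0 x) => [v|] // _; exists (x, v) => f fJ' fV' /=.
have /connectP[[|w s] /=] := conV _ _ fV fV'.
  by move=> _ /phi_inj ->.
move=> /andP[fw _] _; have := noe [set phi f0; w].
by rewrite /= -/(adj H (phi f0) w) fw !inE eqxx.
Qed.

(** A tree of the cover yields a point lying on all the partial transversals
whose vertices it covers; the points obtained meet every partial transversal. *)
Lemma tc_lower : q.+1 * b <= tc r E.
Proof.
have [col colP] := exists_bad_colouring.
have [C [Cm Cmono Ccov]] := tc_coverable E col.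
apply: leq_trans Cm; rewrite leqNgt; apply/negP => Cq.
have /choice[k kP] (H : {set T} * {set {set T}}) :
    exists xv : 'I_(4 * q) * 'I_b, mono_tree E col H ->
    forall f, f \in J -> phi f \in H.1 -> f xv.1 = Some xv.2.
  have [/colP[xv xvP]|nm] := pselect (mono_tree E col H); first by exists xv.
  have x0 : 0 < 4 * q by lia.
  by exists (Ordinal x0, Ordinal b_gt0).
have [|f [fJ fP]] := @avoiding_partial _ b (k @: C) q.
  exact: leq_ltn_trans (leq_imset_card _ _) Cq.
have /bigcupP[H HC fH] : phi f \in \bigcup_(H in C) H.1 by rewrite Ccov inE.
have fJ' : f \in J by rewrite inE.
have := fP _ _ (kP H (Cmono _ HC) f fJ' fH).
by rewrite -surjective_pairing imset_f.
Qed.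

Lemma tc_gt0 : 0 < #|T| -> 0 < r -> 0 < tc r E.
Proof.
move=> /card_gt0P[x _] r0; have [C [Cm _ Ccov]] := tc_coverable E (fun=> Ordinal r0).
have /bigcupP[H HC _] : x \in \bigcup_(H in C) H.1 by rewrite Ccov inE.
by apply: leq_trans Cm; apply/card_gt0P; exists H.
Qed.

End Lower.

(** * Events on the edges of a random graph *)

Section RandomGraph.
Variables (R : realType) (T : finType) (p : R).
Hypothesis p01 : 0 <= p <= 1.
Implicit Types (E D : {set {set T}}) (z u w : T) (S U W Z : {set T}).

Notation Pr := (bprob p (pairs T)).

Definition star z S : {set {set T}} := [set [set z; u] | u in S].

Lemma adj_star E z S u : u \in S -> adj (E :&: star z S) z u = adj E z u.
Proof.
move=> uS; rewrite /adj in_setI (_ : _ \in star z S) ?andbT //.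
by apply/imsetP; exists u.
Qed.

Lemma disjoint_stars S S' z z' : z \notin S' -> z' \notin S ->
  (z != z') || [disjoint S & S'] -> [disjoint star z S & star z' S'].
Proof.
move=> zS zS' dif; rewrite -setI_eq0 -subset0; apply/subsetP => e.
rewrite inE => /andP[/imsetP[u uS ->] /imsetP[u' u'S] /setP ee].
have := ee z; rewrite !inE eqxx /= => /esym /orP[/eqP ezz'|/eqP ezu'].
  move: dif; rewrite ezz' eqxx /= => /disjointFr /(_ uS) uS'.
  have := ee u; rewrite !inE eqxx orbT => /esym /orP[/eqP e1|/eqP e1].
    by move: zS'; rewrite -e1 uS.
  by move: uS'; rewrite e1 u'S.
by move: zS; rewrite ezu' u'S.
Qed.

Lemma pair_in z u : z != u -> [set z; u] \in pairs T.
Proof. by move=> zu; rewrite inE cards2 zu. Qed.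

Lemma prob_adj z u : z != u -> Pr (fun E => adj E z u) = p.
Proof. by move=> zu; rewrite bprob_in // pair_in. Qed.

(** Events at distinct vertices of Z that only concern the edges to S are
independent. *)
Lemma prob_stars (Z S : {set T}) (G : T -> pred {set {set T}}) :
  [disjoint Z & S] -> (forall z, z \in Z -> event_on (star z S) (G z)) ->
  Pr (fun E => [forall z in Z, G z E]) = \prod_(z in Z) Pr (G z).
Proof.
move=> dis GS; apply: (@bprob_forall _ _ _ _ _ _ (fun z => star z S)) => // z z' zZ z'Z zz'.
by apply: disjoint_stars; rewrite ?zz' // (disjointFr dis).
Qed.

Lemma prob_star_edges (I : finType) (J : {set I}) (h : I -> T) (G : T -> pred {set {set T}}) z :
  {in J &, injective h} -> (forall i, i \in J -> h i != z) ->
  (forall i, i \in J -> event_on [set [set z; h i]] (G (h i))) ->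
  Pr (fun E => [forall i in J, G (h i) E]) = \prod_(i in J) Pr (G (h i)).
Proof.
move=> hinj hz GS.
apply: (@bprob_forall _ _ _ _ _ _ (fun i => [set [set z; h i]])) => // i j iJ jJ ij.
rewrite disjoints1 inE; apply: contraNneq ij => /setP /(_ (h i)).
by rewrite !inE eqxx orbT (negPf (hz i iJ)) => /esym/eqP /hinj ->.
Qed.

Lemma prob_all_adj (I : finType) (J : {set I}) (h : I -> T) z :
  {in J &, injective h} -> (forall i, i \in J -> h i != z) ->
  Pr (fun E => [forall i in J, adj E z (h i)]) = p ^+ #|J|.
Proof.
move=> hinj hz; rewrite (prob_star_edges (G := fun u E => adj E z u) hinj hz).
  rewrite (eq_bigr (fun=> p)) ?prodr_const // => i iJ.
  by rewrite prob_adj // eq_sym hz.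
by move=> i iJ E; rewrite /adj !inE eqxx andbT.
Qed.

Lemma prob_none_adj W z : z \notin W ->
  Pr (fun E => [forall w in W, ~~ adj E z w]) = (1 - p) ^+ #|W|.
Proof.
move=> zW; have hz w : w \in W -> w != z by move=> wW; apply: contraNneq zW => <-.
rewrite (@prob_star_edges _ W id (fun w E => ~~ adj E z w) z) //=.
  rewrite (eq_bigr (fun=> 1 - p)) ?prodr_const // => w wW.
  by rewrite bprobC // prob_adj // eq_sym hz.
by move=> w wW E; rewrite /adj !inE eqxx andbT.
Qed.

(** Events of the form exists are turned into negated conjunctions, to which
independence applies. *)
Lemma exists_forallN (P : {set T}) (Q : pred T) :
  [exists w in P, Q w] = ~~ [forall w in P, ~~ Q w].
Proof. by rewrite negb_forall_in; apply: eq_existsb => w; rewrite negbK. Qed.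

(** The edges to U are independent of those to W. *)
Lemma prob_joint_nbr U W z : z \notin U :|: W -> [disjoint U & W] ->
  Pr (fun E => ~~ ([forall u in U, adj E z u] && [exists w in W, adj E z w]))
  = 1 - p ^+ #|U| * (1 - (1 - p) ^+ #|W|).
Proof.
rewrite inE negb_or => /andP[zU zW] dis.
rewrite bprobC // (@bprobI _ _ _ _ (star z U) (star z W)).
- congr (1 - _ * _).
    rewrite (@prob_all_adj _ U id) // => u uU.
    by apply: contraNneq zU => <-.
  rewrite -(prob_none_adj zW) -bprobC //; apply: eq_bprob => E _.
  exact: exists_forallN.
- by move=> E; apply: eq_forallb => u; case: (boolP (u \in U)) => //= uU; rewrite adj_star.
- by move=> E; apply: eq_existsb => u; case: (boolP (u \in W)) => //= uW; rewrite adj_star.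
- by apply: disjoint_stars; rewrite ?dis ?orbT.
Qed.

(** The vertices of Z fail independently of each other. *)
Lemma prob_not_expanding_at U W Z :
  [disjoint U & W] -> [disjoint Z & U :|: W] ->
  Pr (fun E => [disjoint Z & joint_nbhd E U W])
  = (1 - p ^+ #|U| * (1 - (1 - p) ^+ #|W|)) ^+ #|Z|.
Proof.
move=> dUW dZ.
rewrite (@eq_bprob _ _ _ _ _ (fun E => [forall z in Z,
    ~~ ([forall u in U, adj E z u] && [exists w in W, adj E z w])])); last first.
  move=> E _; rewrite disjoints_subset; apply/subsetP/forall_inP => h z /h;
  by rewrite !inE.
rewrite (prob_stars dZ).
  rewrite (eq_bigr (fun=> 1 - p ^+ #|U| * (1 - (1 - p) ^+ #|W|))) ?prodr_const // => z zZ.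
  by rewrite prob_joint_nbr // (disjointFr dZ).
move=> z zZ E; congr (~~ (_ && _)).
  by apply: eq_forallb => u; case: (boolP (u \in U)) => //= uU; rewrite adj_star // inE uU.
by apply: eq_existsb => u; case: (boolP (u \in W)) => //= uU; rewrite adj_star // inE uU orbT.
Qed.

Lemma prob_no_edge (A B : {set T}) : [disjoint A & B] ->
  Pr (fun E => ~~ [exists x in A, exists y in B, adj E x y])
  = ((1 - p) ^+ #|B|) ^+ #|A|.
Proof.
move=> dis.
rewrite (@eq_bprob _ _ _ _ _ (fun E => [forall x in A, [forall y in B, ~~ adj E x y]])); last first.
  move=> E _; rewrite exists_forallN negbK; apply: eq_forallb => x.
  by rewrite exists_forallN negbK.
rewrite (prob_stars dis).
  rewrite (eq_bigr (fun=> (1 - p) ^+ #|B|)) ?prodr_const // => x xA.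
  by rewrite prob_none_adj // (disjointFr dis).
move=> z zZ E.
by apply: eq_forallb => u; case: (boolP (u \in B)) => //= uU; rewrite adj_star.
Qed.

Lemma ffact_leq_expn n k : (n ^_ k <= n ^ k)%N.
Proof.
elim: k => [|k IH]; first by rewrite ffactn0.
by rewrite ffactnSr expnSr leq_mul // leq_subr.
Qed.

(** Union bound over the subsets with k elements, of which there are at most
#|T| ^+ k. *)
Lemma prob_exists_subset k x (A : {set T} -> pred {set {set T}}) : 0 <= x ->
  (forall S, #|S| = k -> Pr (A S) <= x) ->
  Pr (fun E => [exists S : {set T}, (#|S| == k) && A S E]) <= #|T|%:R ^+ k * x.
Proof.
move=> x0 Ax; apply: le_trans (bprob_exists p01 _ _ _) _.
apply: le_trans (_ : \sum_(S : {set T} | #|S| == k) x <= _).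
  by apply: ler_sum => S /eqP /Ax.
rewrite sumr_const -[leLHS]mulr_natl; apply: ler_wpM2r => //.
rewrite -natrX ler_nat (_ : #|_| = #|[set S : {set T} | #|S| == k]|); last first.
  by apply: eq_card => S; rewrite inE.
rewrite card_draws; apply: leq_trans (ffact_leq_expn _ _).
by rewrite -bin_ffact leq_pmulr // fact_gt0.
Qed.

Lemma card_all_sets (X : finType) : #|{: {set X}}| = (2 ^ #|X|)%N.
Proof. by rewrite -[LHS]cardsT -powersetT card_powerset cardsT. Qed.

Lemma extend_subset (A : {set T}) k : (#|A| <= k <= #|T|)%N ->
  exists2 B : {set T}, A \subset B & #|B| = k.
Proof.
move=> /andP[Ak kT].
have [|B BA cB] := @extract_subset _ (~: A) (k - #|A|).
  by have := cardsC A; lia.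
exists (A :|: B); first exact: subsetUl.
have dAB : [disjoint A & B] by rewrite disjoint_sym disjoints_subset.
by rewrite cardsU (eqP (_ : A :&: B == set0)) ?setI_eq0 // cards0 cB; lia.
Qed.

Lemma prob_not_joined a x : 0 <= x ->
  (forall k, (#|T| <= 2 * k)%N -> ((1 - p) ^+ k) ^+ a <= x) ->
  Pr (fun E => ~~ well_joined a E) <= #|T|%:R ^+ a * (2 ^+ #|T| * x).
Proof.
move=> x0 hx.
apply: le_trans (_ : Pr (fun E => [exists A : {set T}, (#|A| == a) &&
   [exists B : {set T}, ((#|T| <= 2 * #|B|)%N && [disjoint A & B]) &&
     ~~ [exists x in A, exists y in B, adj E x y]]]) <= _).
  apply: le_bprob => // E _; rewrite negb_forall => /existsP[A].
  rewrite negb_forall => /existsP[B]; rewrite negb_imply.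
  move=> /andP[/and3P[cA cB dAB] nE]; apply/existsP; exists A; rewrite cA.
  by apply/existsP; exists B; rewrite cB dAB.
apply: prob_exists_subset; first by rewrite mulr_ge0 // exprn_ge0.
move=> A cA; apply: le_trans (bprob_exists p01 _ _ _) _.
apply: le_trans (_ : \sum_(B : {set T} | (#|T| <= 2 * #|B|)%N && [disjoint A & B]) x <= _).
  by apply: ler_sum => B /andP[cB dAB]; rewrite prob_no_edge // cA hx.
rewrite sumr_const -[leLHS]mulr_natl; apply: ler_wpM2r => //.
by rewrite -natrX ler_nat -card_all_sets max_card.
Qed.

(** If expansion fails for U and W, the joint neighbourhood is contained in a
set S with exactly L * #|W| elements, and all vertices outside the three sets
fail to be joint neighbours. The last hypothesis bounds the probability of this
event well enough for union bounds over S, U, W and the size s of W. *)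
Lemma prob_not_expanding a k L y : 0 <= y -> #|T|%:R * y = 1 -> (L * a <= #|T|)%N ->
  (forall s m, (0 < s <= a)%N -> (#|T| <= m + (k + s + L * s))%N ->
     (1 - p ^+ k * (1 - (1 - p) ^+ s)) ^+ m <= y ^+ (k + s + L * s + 2)) ->
  Pr (fun E => ~~ expanding a k L E) <= y.
Proof.
move=> y0 ny La hy; set n := #|T| in ny La hy *.
have nyX i j : n%:R ^+ i * y ^+ (i + j) = y ^+ j.
  by rewrite exprD mulrA -exprMn ny expr1n mul1r.
pose ev W U S E := [disjoint U & W] && [disjoint ~: (U :|: W :|: S) & joint_nbhd E U W].
apply: le_trans (_ : Pr (fun E => [exists s : 'I_n.+1, (0 < s <= a)%N &&
    [exists W : {set T}, (#|W| == s) && [exists U : {set T}, (#|U| == k) &&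
     [exists S : {set T}, (#|S| == L * s)%N && ev W U S E]]]]) <= _).
  apply: le_bprob => // E _; rewrite negb_forall => /existsP[U].
  rewrite negb_forall => /existsP[W]; rewrite negb_imply -leqNgt.
  move=> /andP[/and3P[cU /andP[W0 Wa] dUW] small].
  have Wn : (#|W| < n.+1)%N by rewrite ltnS; exact: max_card.
  have [|S nS cS] := @extend_subset (joint_nbhd E U W) (L * #|W|).
    by rewrite small (leq_trans _ La) // leq_mul2l Wa orbT.
  apply/existsP; exists (Ordinal Wn); rewrite /= W0 Wa /=.
  apply/existsP; exists W; rewrite eqxx; apply/existsP; exists U; rewrite cU.
  apply/existsP; exists S; rewrite cS eqxx /ev dUW /=.
  by rewrite disjoints_subset setCS (subset_trans nS) // subsetUr.
apply: le_trans (bprob_exists p01 _ _ _) _.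
apply: le_trans (_ : \sum_(s : 'I_n.+1 | (0 < s <= a)%N) y ^+ 2 <= _).
  apply: ler_sum => s sa.
  rewrite -(nyX s 2%N); apply: prob_exists_subset => [|W cW]; first exact: exprn_ge0.
  rewrite -(nyX k (s + 2)%N); apply: prob_exists_subset => [|U cU]; first exact: exprn_ge0.
  rewrite -(nyX (L * s)%N (k + (s + 2))%N).
  apply: prob_exists_subset => [|S cS]; first exact: exprn_ge0.
  rewrite /ev; have [dUW|_] := boolP [disjoint U & W]; last first.
    by rewrite /bprob bexp_cst exprn_ge0.
  rewrite prob_not_expanding_at //; last first.
    by rewrite disjoints_subset setCS subsetUl.
  rewrite (_ : (L * s + (k + (s + 2)) = k + s + L * s + 2)%N); last by lia.
  rewrite cU cW; apply: hy => //.
  rewrite -[leqLHS](cardsC (U :|: W :|: S)) addnC leq_add2l.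
  apply: leq_trans (leq_card_setU _ _) _; rewrite cS leq_add2r.
  by apply: leq_trans (leq_card_setU _ _) _; rewrite cU cW.
rewrite sumr_const -[leLHS]mulr_natl expr2.
have n0 : (0 < n)%N by rewrite lt0n; apply: contra_eq_neq ny => ->; rewrite mul0r eq_sym oner_eq0.
have yE : y = n%:R * (y * y) by rewrite mulrA ny mul1r.
rewrite [leRHS]yE ler_wpM2r ?mulr_ge0 // ler_nat.
apply: leq_trans (_ : #|[set~ (ord0 : 'I_n.+1)]| <= _)%N; last by rewrite cardsC1 card_ord.
apply: subset_leq_card; apply/subsetP => s; rewrite !inE unfold_in => /andP[s0 _].
by rewrite -val_eqE /= -lt0n.
Qed.

Section Candidates.
Variables (M : nat) (I : finType) (phi : 'I_M * I -> T) (k : nat).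
Hypothesis phi_inj : injective phi.
Hypothesis k_gt0 : (0 < k)%N.

Definition sparse_nbrs i E := [forall w, (#|[set f | adj E w (phi (i, f))]| < k)%N].

Definition independent_image i E := [forall f, forall g, ~~ adj E (phi (i, f)) (phi (i, g))].

Let Z : {set T} := phi @: [set: _].

Let outer i E := [forall w in ~: Z, (#|[set f | adj E w (phi (i, f))]| < k)%N].

Let row i : {set T} := [set phi (i, f) | f in I].

Let phiZ a : phi a \in Z.
Proof. exact: imset_f. Qed.

Let prob_crowded i w : w \in ~: Z ->
  Pr (fun E => ~~ (#|[set f | adj E w (phi (i, f))]| < k)%N) <= 2 ^+ #|I| * p ^+ k.
Proof.
move=> wZ.
have hz (J : {set I}) f : f \in J -> phi (i, f) != w.
  by move=> _; apply: contraTneq wZ => <-; rewrite inE phiZ.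
apply: le_trans (_ : Pr (fun E => [exists J : {set I}, (#|J| == k) &&
    [forall f in J, adj E w (phi (i, f))]]) <= _).
  apply: le_bprob => // E _; rewrite -leqNgt => /extract_subset[J /subsetP JS cJ].
  apply/existsP; exists J; rewrite cJ eqxx; apply/forall_inP => f /JS.
  by rewrite inE.
apply: le_trans (bprob_exists p01 _ _ _) _.
apply: le_trans (_ : \sum_(J : {set I} | #|J| == k) p ^+ k <= _).
  apply: ler_sum => J /eqP cJ.
  rewrite (@prob_all_adj _ J (fun f => phi (i, f))) ?cJ //; last exact: hz.
  by move=> f g _ _ /phi_inj[].
have p0 : 0 <= p by case/andP: p01.
rewrite sumr_const -[leLHS]mulr_natl; apply: ler_wpM2r; first exact: exprn_ge0.
by rewrite -natrX ler_nat -card_all_sets max_card.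
Qed.

Let count_row i w E : #|[set f | adj (E :&: star w (row i)) w (phi (i, f))]|
  = #|[set f | adj E w (phi (i, f))]|.
Proof.
apply: eq_card => f; rewrite !inE adj_star //.
by apply/imsetP; exists f.
Qed.

Let prob_outer i : 2 ^+ #|I| * p ^+ k <= 1 ->
  (1 - 2 ^+ #|I| * p ^+ k) ^+ #|T| <= Pr (outer i).
Proof.
set x := _ * _ => x1.
have p0 : 0 <= p by case/andP: p01.
have x0 : 0 <= x by rewrite mulr_ge0 ?exprn_ge0.
rewrite /outer (@prob_stars (~: Z) (row i)
  (fun w E => (#|[set f | adj E w (phi (i, f))]| < k)%N)); last first.
- by move=> w _ E; rewrite count_row.
- rewrite disjoint_sym disjoints_subset setCK; apply/subsetP => _ /imsetP[f _ ->].
  exact: phiZ.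
apply: le_trans (_ : (1 - x) ^+ #|~: Z| <= _).
  by apply: ler_wiXn2l; rewrite ?subr_ge0 // ?max_card // lerBlDr lerDl.
rewrite -prodr_const; apply: ler_prod => w wZ.
rewrite subr_ge0 x1 /= lerBlDr -lerBlDl -bprobC //; exact: prob_crowded.
Qed.

Let prob_no_outer : 2 ^+ #|I| * p ^+ k <= 1 ->
  Pr (fun E => [forall i in [set: 'I_M], ~~ outer i E])
  <= (1 - (1 - 2 ^+ #|I| * p ^+ k) ^+ #|T|) ^+ M.
Proof.
move=> x1.
pose D i := [set [set u.1; u.2] | u in setX (~: Z) (row i)].
rewrite (@bprob_forall _ _ _ _ _ _ D) //.
- apply: (@le_trans _ _
    (\prod_(i in [set: 'I_M]) (1 - (1 - 2 ^+ #|I| * p ^+ k) ^+ #|T|))); last first.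
    by rewrite prodr_const cardsT card_ord.
  apply: ler_prod => i _.
  by rewrite bprob_ge0 //= bprobC // lerB // prob_outer.
- move=> i _ E; congr (~~ _); apply: eq_forallb => w.
  case: (boolP (w \in ~: Z)) => //= wZ; rewrite -(count_row _ _ E) -(count_row _ _ (E :&: D i)).
  congr (_ < _)%N; apply: eq_card => f; rewrite !inE -setIA; congr (_ \in _ :&: _).
  apply/setIidPr/subsetP => e /imsetP[u ui ->].
  by apply/imsetP; exists (w, u); rewrite // !inE /= -in_setC wZ.
- move=> i j _ _ ij; rewrite -setI_eq0 -subset0; apply/subsetP => e.
  rewrite inE => /andP[/imsetP[[w u] /setXP[/= wZ ui] ->] /imsetP[[w' u'] /setXP[/= wZ' uj]]].
  case/imsetP: ui => f _ ->; case/imsetP: uj => g _ -> /setP /(_ (phi (i, f))).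
  rewrite !inE eqxx orbT => /esym /orP[/eqP e1|/eqP /phi_inj [e1]].
    by move: wZ'; rewrite -e1 inE phiZ.
  by rewrite e1 eqxx in ij.
Qed.

Let prob_edge_inside :
  Pr (fun E => [exists a, exists b, adj E (phi a) (phi b)]) <= (M * #|I|)%:R ^+ 2 * p.
Proof.
have p0 : 0 <= p by case/andP: p01.
apply: le_trans (_ : Pr (fun E => [exists ab : (('I_M * I) * ('I_M * I))%type,
    (ab.1 != ab.2) && adj E (phi ab.1) (phi ab.2)]) <= _).
  apply: le_bprob => // E /subsetP EP /existsP[a /existsP[b Eab]].
  apply/existsP; exists (a, b); rewrite Eab andbT /=.
  by apply: contraTneq Eab => ->; apply/negP => /EP; rewrite inE setUid cards1.
apply: le_trans (bprob_exists p01 _ _ _) _.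
apply: le_trans (_ : \sum_(ab : (('I_M * I) * ('I_M * I))%type | ab.1 != ab.2) p <= _).
  apply: ler_sum => -[a b] /= ab; rewrite prob_adj //.
  by apply: contraNneq ab => /phi_inj ->.
rewrite sumr_const -[leLHS]mulr_natl; apply: ler_wpM2r => //.
rewrite -natrX ler_nat; apply: leq_trans (max_card _) _.
by rewrite !card_prod card_ord expnS expn1.
Qed.

(** The first summand bounds the probability that the image of phi spans an edge.
If it does not, only neighbours w outside the image matter, and the M rows have
independent chances of being sparsely joined to these w. *)
Lemma prob_no_candidate : 2 ^+ #|I| * p ^+ k <= 1 ->
  Pr (fun E => ~~ [exists i, sparse_nbrs i E && independent_image i E])
  <= (M * #|I|)%:R ^+ 2 * p + (1 - (1 - 2 ^+ #|I| * p ^+ k) ^+ #|T|) ^+ M.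
Proof.
move=> x1; apply: le_trans (lerD prob_edge_inside (prob_no_outer x1)).
apply: le_trans (bprobU p01 _ _ _); apply: le_bprob => // E _.
move=> /existsPn nc.
have [//|/existsPn noE] := boolP [exists a, exists b, adj E (phi a) (phi b)]; rewrite /=.
have indep a b : ~~ adj E (phi a) (phi b) by move/existsPn: (noE a) => /(_ b).
apply/forall_inP => i _; apply: contra (nc i) => /forall_inP out.
apply/andP; split; last by apply/forallP => f; apply/forallP => g; exact: indep.
apply/forallP => w; have [/imsetP[a _ ->]|] := boolP (w \in Z); last first.
  by rewrite -in_setC => /out.
rewrite (eqP (_ : [set f | _] == set0)) ?cards0 // -subset0.
by apply/subsetP => f; rewrite !inE (negPf (indep _ _)).
Qed.

End Candidates.

End RandomGraph.

(** * Elementary real estimates *)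

Section RealEstimates.
Variable R : realType.
Implicit Types (p x t : R).

(** Since (1 - p) * (1 + p) is at most 1, this follows from Bernoulli's
inequality for 1 + p. *)
Lemma expX_bernoulli p s : 0 <= p <= 1 -> (1 - p) ^+ s * (1 + s%:R * p) <= 1.
Proof.
move=> /andP[p0 p1]; elim: s => [|s IH]; first by rewrite expr0 mul0r addr0 mulr1.
apply: le_trans IH; rewrite exprSr -mulrA.
apply: ler_wpM2l; first by rewrite exprn_ge0 // subr_ge0.
have : 0 <= s%:R * (p * p) + p * p by rewrite addr_ge0 ?mulr_ge0.
by rewrite -natr1; lra.
Qed.

Lemma prob_hit_ge p s : 0 <= p <= 1 -> s%:R * p <= 5 ->
  s%:R * p / 6 <= 1 - (1 - p) ^+ s.
Proof.
move=> p01 sp; have := expX_bernoulli s p01; case/andP: p01 => p0 p1.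
have : 0 <= (1 - p) ^+ s by rewrite exprn_ge0 // subr_ge0.
have : (1 - p) ^+ s <= 1 by rewrite exprn_ile1 ?subr_ge0 // lerBlDr lerDl.
have : 0 <= s%:R * p by rewrite mulr_ge0.
move: (_ ^+ s) (_ * _) sp => t x; nra.
Qed.

Lemma onem_le_expR x : 1 - x <= expR (- x).
Proof. exact: expR_ge1Dx. Qed.

Lemma onemX_le_expR x k : 0 <= x <= 1 -> (1 - x) ^+ k <= expR (- (k%:R * x)).
Proof.
move=> /andP[x0 x1]; rewrite -mulrN expRM_natl.
by apply: lerXn2r; rewrite ?nnegrE ?subr_ge0 ?expR_ge0 ?onem_le_expR.
Qed.

Lemma expRN_le_inv t : 0 < t -> expR (- t) <= t^-1.
Proof.
move=> t0; rewrite expRN lef_pV2 ?posrE ?expR_gt0 //.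
by apply: le_trans (expR_ge1Dx t); rewrite lerDr.
Qed.

Lemma invn_expR n k : (0 < n)%N -> (n%:R^-1 : R) ^+ k = expR (- (k%:R * ln n%:R)).
Proof.
move=> n0; rewrite -mulrN expRM_natl expRN lnK // posrE ltr0n //.
Qed.

Lemma natX_expR n k : (0 < n)%N -> (n%:R : R) ^+ k = expR (k%:R * ln n%:R).
Proof. by move=> n0; rewrite expRM_natl lnK // posrE ltr0n. Qed.

Lemma exp2X_le_expR n : (2 : R) ^+ n <= expR n%:R.
Proof.
rewrite -[n%:R]mulr1 expRM_natl; apply: lerXn2r; rewrite ?nnegrE ?expR_ge0 //.
by apply: le_trans (expR_ge1Dx 1).
Qed.

Lemma onem_ge_expR x : 0 <= x <= 2^-1 -> expR (- (2 * x)) <= 1 - x.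
Proof.
move=> /andP[x0 x2]; have e0 := expR_gt0 (2 * x).
rewrite expRN -div1r ler_pdivrMr //.
have : (1 - x) * (1 + 2 * x) <= (1 - x) * expR (2 * x).
  by apply: ler_wpM2l; [lra | exact: expR_ge1Dx].
nra.
Qed.

End RealEstimates.

(** * The random graph expands *)

Lemma half_bound n r s t m : (0 < r -> 4 * r <= n -> 4 * (t + s) <= n ->
  n <= m + (r.-1 + s + t) -> n <= 2 * m)%N.
Proof. lia. Qed.

Lemma exponent_bound L r s : (0 < r -> 0 < s ->
  r.-1 + s + L * s + 2 <= s * (L + r + 2))%N.
Proof. by move=> r0 s0; have := leq_pmull r s0; rewrite !mulnDr (mulnC s L); lia. Qed.

Section UpperProbability.
Variables (R : realType) (n r : nat) (p : R).
Let L := ((2 * r) ^ r)%N.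
Hypotheses (p01 : 0 <= p <= 1) (r_gt0 : (0 < r)%N) (rn : (4 * r <= n)%N).
Hypothesis ln_ge1 : 1 <= ln n%:R :> R.
Hypothesis p_large : (20 * (L + r + 2))%:R * ln n%:R <= p ^+ r * n%:R.

Let n_gt0 : (0 < n)%N. Proof. by lia. Qed.

Let p_gt0 : 0 < p.
Proof.
rewrite lt_neqAle eq_sym; case/andP: p01 => -> _; rewrite andbT.
apply: contraTneq p_large => ->.
rewrite expr0n gtn_eqF // mul0r -ltNge.
by rewrite mulr_gt0 ?ltr0n ?muln_gt0 // ?addn_gt0 ?orbT // (lt_le_trans _ ln_ge1).
Qed.

(** This size a satisfies 4 <= a * p <= 5. The lower bound makes edges between
sets of sizes a and n / 2 certain enough for a union bound over 2 ^ n sets; the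
upper bound keeps the probability of being joined to a set of s <= a vertices
comparable to s * p. *)
Definition joining_size : nat := (Num.truncn (4 / p)).+1.
Let a := joining_size.

Let a_bounds : 4 <= a%:R * p <= 5.
Proof.
have /andP[lo hi] : (Num.truncn (4 / p))%:R <= 4 / p < a%:R.
  by apply: truncn_itv; rewrite divr_ge0 // ltW.
case/andP: p01 => _ p1.
apply/andP; split; first by rewrite -ler_pdivrMr // ltW.
rewrite /a /joining_size -natr1 mulrDl mul1r.
by move: lo; rewrite ler_pdivlMr //; lra.
Qed.

Let a_small : a%:R * (20 * (L + r + 2))%:R * ln n%:R <= 5 * n%:R :> R.
Proof.
have pr : p ^+ r <= p by case/andP: p01 => p0 p1; exact: ler_iXnr.
case/andP: a_bounds => _ a5.
apply: le_trans (_ : a%:R * p * n%:R <= _); last by apply: ler_wpM2r.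
rewrite -!mulrA; apply: ler_wpM2l => //; apply: le_trans p_large _.
exact: ler_wpM2r.
Qed.

Let aL : (4 * ((L + 1) * a) <= n)%N.
Proof.
rewrite -(ler_nat R).
have : (20 * (L + 1) * a)%:R <= 5 * n%:R :> R.
  apply: le_trans a_small; rewrite -natrM -[leLHS]mulr1.
  by apply: ler_pM => //; rewrite ler_nat; nia.
rewrite -natrM !ler_nat; lia.
Qed.

Let prob_joined :
  bprob p (pairs 'I_n) (fun E => ~~ well_joined a E) <= 2 / n%:R :> R.
Proof.
case/andP: a_bounds => a4 _; have [p0 p1] := andP p01.
apply: le_trans (prob_not_joined (x := expR (- (2 * n%:R) : R)) p01 _ _) _.
- exact: expR_ge0.
- move=> k; rewrite card_ord => nk; rewrite -exprM.
  apply: le_trans (onemX_le_expR _ p01) _; rewrite ler_expR lerN2 natrM.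
  have : (n%:R : R) <= 2 * k%:R by rewrite -natrM ler_nat.
  have : 0 <= (k%:R : R) by [].
  rewrite -mulrA; move: (_ * p) (k%:R) (n%:R : R) a4 => x k' n' *; nra.
rewrite card_ord mulrA.
apply: le_trans (_ : expR (a%:R * ln n%:R) * expR n%:R * expR (- (2 * n%:R)) <= _).
  rewrite natX_expR //; apply: ler_wpM2r; first exact: expR_ge0.
  by apply: ler_wpM2l; [exact: expR_ge0 | exact: exp2X_le_expR].
rewrite -!expRD -[leRHS]invf_div.
apply: le_trans (expRN_le_inv (_ : 0 < n%:R / 2)); last by rewrite divr_gt0 ?ltr0n.
rewrite ler_expR.
have : 20 * (a%:R * ln n%:R) <= 5 * n%:R :> R.
  apply: le_trans a_small; rewrite mulrA; apply: ler_wpM2r; first by apply: le_trans ln_ge1.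
  by rewrite mulrC ler_wpM2l // ler_nat; lia.
have : 0 <= n%:R :> R by [].
lra.
Qed.

Let prob_expanding :
  bprob p (pairs 'I_n) (fun E => ~~ expanding a r.-1 L E) <= n%:R^-1.
Proof.
have [p0 p1] := andP p01; have n0 : 0 < (n%:R : R) by rewrite ltr0n.
apply: prob_not_expanding => //.
- by rewrite invr_ge0 ltW.
- by rewrite card_ord divff // gt_eqF.
- by rewrite card_ord; nia.
move=> s m /andP[s0 sa]; rewrite card_ord => nm.
have sp5 : s%:R * p <= 5.
  case/andP: a_bounds => _; apply: le_trans; apply: ler_wpM2r => //.
  by rewrite ler_nat.
have hit := prob_hit_ge p01 sp5.
have hit1 : 1 - (1 - p) ^+ s <= 1 by rewrite lerBlDr lerDl exprn_ge0 // subr_ge0.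
have sp0 : 0 <= s%:R * p by rewrite mulr_ge0.
set q := p ^+ r.-1 * _.
have q_ge : s%:R * p ^+ r / 6 <= q.
  rewrite -[in leLHS](prednK r_gt0) exprS.
  rewrite (_ : _ / 6 = p ^+ r.-1 * (s%:R * p / 6)); last by ring.
  by apply: ler_wpM2l; rewrite ?exprn_ge0.
have q01 : 0 <= q <= 1.
  apply/andP; split; first by apply: le_trans q_ge; rewrite divr_ge0 // mulr_ge0 // exprn_ge0.
  apply: mulr_ile1 => //; rewrite ?exprn_ge0 ?exprn_ile1 //.
  by apply: le_trans hit; rewrite divr_ge0.
apply: le_trans (onemX_le_expR _ q01) _.
rewrite invn_expR // ler_expR lerN2.
have nm2 : (n%:R : R) <= 2 * m%:R.
  rewrite -natrM ler_nat.
  have : (4 * ((L + 1) * s) <= n)%N by apply: leq_trans aL; rewrite !leq_mul2l sa orbT.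
  by rewrite mulnDl mul1n => sL; exact: half_bound r_gt0 rn sL nm.
apply: le_trans (_ : (s * (L + r + 2))%:R * ln n%:R <= _).
  apply: ler_wpM2r; first by apply: le_trans ln_ge1.
  by rewrite ler_nat exponent_bound.
apply: le_trans (_ : m%:R * (s%:R * p ^+ r / 6) <= _); last exact: ler_wpM2l.
move: p_large; rewrite !natrM.
have : 0 <= (s%:R : R) by [].
have : 0 <= p ^+ r by rewrite exprn_ge0.
have : 0 <= ln (n%:R : R) by apply: le_trans ln_ge1.
have : 0 <= (L + r + 2)%:R :> R by [].
move: (p ^+ r) ((L + r + 2)%:R) (ln _) => P Q l Q0 l0 P0 s0' h.
have hs : s%:R * (20 * Q * l) <= s%:R * (P * n%:R) by apply: ler_wpM2l.
have : s%:R * P * n%:R <= s%:R * P * (2 * m%:R).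
  by apply: ler_wpM2l => //; rewrite mulr_ge0.
have : 0 <= s%:R * Q * l by rewrite !mulr_ge0.
lra.
Qed.

Lemma prob_tc_upper :
  1 - 3 / n%:R <= bprob p (pairs 'I_n) (fun E => (tc r E <= 4 * r ^ 2)%N).
Proof.
rewrite lerBlDr -lerBlDl -bprobC //.
apply: le_trans (_ : bprob p (pairs 'I_n)
   (fun E => ~~ well_joined a E || ~~ expanding a r.-1 L E) <= _).
  apply: le_bprob => // E _; apply: contraR.
  rewrite negb_or !negbK => /andP[jE xE].
  by apply: tc_upper jE xE; rewrite // card_ord.
apply: le_trans (bprobU p01 _ _ _) _.
by apply: le_trans (lerD prob_joined prob_expanding) _; lra.
Qed.

End UpperProbability.

(** * The random graph has a sparse independent set *)

Section LowerProbability.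
Variables (R : realType) (n k N : nat) (I : finType) (p : R).
Let m := #|I|.
Hypotheses (p01 : 0 <= p <= 1) (k_gt0 : (0 < k)%N) (N_gt0 : (0 < N)%N) (mN : (m <= N)%N).
Hypothesis Nn : (N ^ (16 * k) <= n < N.+1 ^ (16 * k))%N.
Hypothesis p_small : p ^+ k * n%:R <= (16 * k * 2 ^ m.+1)%:R^-1 * ln n%:R.

Let n_gt0 : (0 < n)%N.
Proof. by case/andP: Nn => h _; apply: leq_trans h; rewrite expn_gt0 N_gt0. Qed.

Let N_leX j : (j <= 16 * k)%N -> (N ^ j <= n)%N.
Proof.
by move=> jk; case/andP: Nn => h _; apply: leq_trans h; rewrite leq_pexp2l.
Qed.

Let k16 : [/\ (8 * k).+1 <= 16 * k, 3 <= 16 * k & 1 <= 16 * k]%N.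
Proof. by move: k_gt0 => k0; split; lia. Qed.

Let ln_small : ln n%:R <= (16 * k)%:R * ln N.+1%:R :> R.
Proof.
rewrite mulr_natl -lnXn ?ltr0n // ler_ln ?posrE ?exprn_gt0 ?ltr0n //.
by rewrite -natrX ler_nat; case/andP: Nn => _ /ltnW.
Qed.

Let x := 2 ^+ m * p ^+ k.

Let x_ge0 : 0 <= x.
Proof. by rewrite mulr_ge0 ?exprn_ge0 //; case/andP: p01. Qed.

Let xn_small : 2 * x * n%:R <= ln N.+1%:R.
Proof.
have k0 : 0 < (16 * k)%:R :> R by rewrite ltr0n muln_gt0.
have two0 : 0 < (2 ^ m.+1)%:R :> R by rewrite ltr0n expn_gt0.
have -> : 2 * x * n%:R = (2 ^ m.+1)%:R * (p ^+ k * n%:R).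
  by rewrite natrX exprS /x !mulrA.
apply: le_trans (_ : (2 ^ m.+1)%:R * ((16 * k * 2 ^ m.+1)%:R^-1 * ln n%:R) <= _).
  by apply: ler_wpM2l => //; exact: ltW.
rewrite natrM invfM mulrA mulrCA divff ?gt_eqF // mulr1 mulrC.
by rewrite ler_pdivrMr // mulrC ln_small.
Qed.

Let ln_leN : ln N.+1%:R <= N%:R :> R.
Proof.
have : 1 + N%:R <= expR N%:R :> R by exact: expR_ge1Dx.
rewrite addrC natr1 => h; rewrite -[leRHS]expRK ler_ln ?posrE ?expR_gt0 ?ltr0n //.
Qed.

Let pN : p * N%:R ^+ 8 <= 1.
Proof.
have p0 : 0 <= p by case/andP: p01.
have N0 : 0 < N%:R :> R by rewrite ltr0n.
have n0 : 0 < n%:R :> R by rewrite ltr0n.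
rewrite -(@expr_le1 _ k) //; last by rewrite mulr_ge0 // exprn_ge0 // ltW.
rewrite exprMn -exprM -(ler_pM2r N0) mul1r -mulrA -exprSr.
apply: le_trans (_ : p ^+ k * n%:R <= _).
  apply: ler_wpM2l; first exact: exprn_ge0.
  by rewrite -natrX ler_nat N_leX //; case: k16.
apply: le_trans ln_leN; apply: le_trans xn_small.
apply: ler_wpM2r; first exact: ltW.
rewrite /x mulrA -exprS ler_peMl ?exprn_ge0 // exprn_ege1 //; lra.
Qed.

Let x_half : x <= 2^-1.
Proof.
have n0 : 0 < n%:R :> R by rewrite ltr0n.
have Nle : N%:R <= n%:R :> R.
  by rewrite ler_nat -[N]expn1 N_leX //; case: k16.
have : 2 * x * n%:R <= 1 * n%:R.
  by rewrite mul1r; apply: le_trans xn_small (le_trans ln_leN Nle).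
rewrite ler_pM2r //; lra.
Qed.

Let candidates_rare : (1 - (1 - x) ^+ n) ^+ (N ^ 2) <= 2 / N%:R.
Proof.
have N0 : 1 <= N%:R :> R by rewrite ler1n.
have x01 : 0 <= x <= 2^-1 by rewrite x_ge0 x_half.
have hit : N.+1%:R^-1 <= (1 - x) ^+ n.
  apply: le_trans (_ : expR (- (2 * x)) ^+ n <= _); last first.
    apply: lerXn2r; rewrite ?nnegrE ?expR_ge0 //; last exact: onem_ge_expR.
    by move: x_half; lra.
  rewrite -expRM_natl mulrN expRN lef_pV2 ?posrE ?expR_gt0 ?ltr0n //.
  by rewrite -[leRHS](@lnK R) ?posrE ?ltr0n // ler_expR mulrC.
have y01 : 0 <= (N.+1%:R^-1 : R) <= 1.
  by rewrite invr_ge0 ler0n invf_le1 ?ltr0n // ler1n.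
apply: le_trans (_ : (1 - N.+1%:R^-1) ^+ (N ^ 2) <= _).
  have h1 : (1 - x) ^+ n <= 1.
    by apply: exprn_ile1; move: x_half x_ge0; lra.
  by apply: lerXn2r; rewrite ?nnegrE ?subr_ge0 //; [case/andP: y01 | exact: lerB].
apply: le_trans (onemX_le_expR _ y01) _.
apply: le_trans (expRN_le_inv _) _.
  by rewrite divr_gt0 ?ltr0n // expn_gt0 N_gt0.
rewrite invf_div natrX ler_pdivrMr ?exprn_gt0 ?ltr0n //.
rewrite expr2 mulrA -natr1 divfK; last by rewrite gt_eqF // ltr0n.
lra.
Qed.

(** N is about the (16 k)-th root of n. A candidate succeeds with probability
at least 1 / (N + 1), so that some of N ^ 2 independent candidates is likely to
do so, and p is at most N ^- 8, so that all of them together are likely to span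
no edge. *)
Lemma prob_candidate : exists phi : nat -> I -> 'I_n,
  (forall i, injective (phi i)) /\
  1 - (m ^ 2 + 2)%:R / N%:R <= bprob p (pairs 'I_n)
    (fun E => [exists i : 'I_(N ^ 2),
       [forall w, (#|[set f | adj E w (phi i f)]| < k)%N] &&
       [forall f, forall g, ~~ adj E (phi i f) (phi i g)]]).
Proof.
have N0 : 1 <= N%:R :> R by rewrite ler1n.
have cle : (#|{: 'I_(N ^ 2) * I}| <= n)%N.
  rewrite card_prod card_ord.
  apply: leq_trans (_ : N ^ 3 <= _)%N; first by rewrite (expnSr _ 2) leq_mul2l mN orbT.
  by rewrite N_leX //; case: k16.
pose phi0 a : 'I_n := widen_ord cle (enum_rank a).
have phi0_inj : injective phi0.
  by move=> a b /(congr1 val) /= /val_inj /enum_rank_inj.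
have M0 : (0 < N ^ 2)%N by rewrite expn_gt0 N_gt0.
have i0 := Ordinal M0.
(* Indices from N ^ 2 on repeat the row i0, which makes phi total on nat. *)
exists (fun i f => phi0 (insubd i0 i, f)); split.
  by move=> i f g /phi0_inj[].
rewrite lerBlDr -lerBlDl -bprobC //.
have x1 : 2 ^+ #|I| * p ^+ k <= 1 by move: x_half; rewrite /x /m; lra.
have := prob_no_candidate p01 phi0_inj k_gt0 x1.
rewrite card_ord -/x => h.
apply: le_trans (_ : (N ^ 2 * m)%:R ^+ 2 * p + 2 / N%:R <= _); last first.
  rewrite natrD [leRHS]mulrDl lerD2r ler_pdivlMr; last by rewrite (lt_le_trans _ N0).
  rewrite natrM exprMn -!natrX -!expnM.
  rewrite (_ : _ * _ * p * N%:R = (m ^ 2)%:R * (p * N%:R ^+ 5)); last first.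
    by rewrite !natrX; ring.
  rewrite -[leRHS]mulr1; apply: ler_wpM2l => //; apply: le_trans pN.
  apply: ler_wpM2l; first by case/andP: p01.
  by apply: ler_weXn2l.
apply: le_trans (lerD (lexx _) candidates_rare); apply: le_trans h.
apply: le_bprob => // E _; apply: contra => /existsP[i /andP[sp ind]].
apply/existsP; exists i; apply/andP; split.
  by apply/forallP => w; move/forallP: sp => /(_ w); rewrite valKd.
apply/forallP => f; apply/forallP => g.
by move/forallP: ind => /(_ f) /forallP /(_ g); rewrite valKd.
Qed.

End LowerProbability.

(** * The number of trees is of order the square of the number of colours *)

Section BlockSizes.
Local Open Scope nat_scope.

(** There are four times quarter r blocks, so that in every half of them a
partial transversal is defined at least quarter r times, and a colour remains
for the edges not meeting the independent set. *)
Definition quarter r := r.-1 %/ 4.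

(** The factor 9 * D is such that a vertex has fewer than
D * r.+1 <= 9 * D * quarter r neighbours in the independent set, as required by
expn_pred_bound. *)
Definition block_size D r := quarter r %/ (9 * D).
Definition template D r : finType := {ffun 'I_(4 * quarter r) -> option 'I_(block_size D r)}.

Lemma integer_root n j : 0 < n -> 0 < j -> exists2 N, 0 < N & N ^ j <= n < N.+1 ^ j.
Proof.
move=> + j0; elim: n => // -[_ _|n IH _].
  by exists 1; rewrite // exp1n /= -{1}(exp1n j) ltn_exp2r.
have [//|N N0 /andP[lo hi]] := IH.
have [up|up] := ltnP n.+2 (N.+1 ^ j); first by exists N => //; rewrite up leqW.
by exists N.+1 => //; rewrite up /= (leq_ltn_trans hi) // ltn_exp2r.
Qed.

Lemma quarter_block_bound D r : 0 < r -> 0 < D ->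
  r ^ 2 <= 32 * (9 * D) ^ 2 *
    (if 0 < block_size D r then (quarter r).+1 * block_size D r else 1).
Proof.
rewrite /block_size /quarter => r0 D0.
set q := r.-1 %/ 4; have rq : r <= 4 * q.+1.
  by rewrite /q; have := ltn_ceil r.-1 (isT : 0 < 4); lia.
have K0 : 0 < 9 * D by lia.
set K := 9 * D in K0 *; have qb := ltn_ceil q K0.
set b := q %/ K in qb *.
have r2 : r ^ 2 <= 16 * q.+1 ^ 2.
  by rewrite -[16]/(4 ^ 2) -expnMn; case: (leqP r (4 * q.+1)) rq => // h _; rewrite leq_exp2r.
apply: leq_trans r2 _; case: ltnP => [b0|b0].
  have h : q.+1 <= 2 * K * b by nia.
  have K2 : K <= K ^ 2 by rewrite -{1}[K]expn1 leq_pexp2l.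
  have := leq_mul (leqnn (16 * q.+1)) h.
  have := leq_mul (leqnn (32 * (q.+1 * b))) K2.
  by rewrite (expnS q.+1) expn1; move: (K ^ 2) => K2'; nia.
have {b0} eb : b = 0 by lia.
have : q.+1 <= K by move: qb; rewrite eb mul1n.
rewrite muln1 => h; apply: leq_trans (_ : 16 * K ^ 2 <= _); last by rewrite leq_mul2r; lia.
by rewrite leq_mul2l leq_exp2r ?orbT.
Qed.

End BlockSizes.

Lemma tc_lower_of_candidate n D r (E : {set {set 'I_n}}) (phi : template D r -> 'I_n) :
  (0 < D)%N -> (0 < block_size D r)%N -> E \subset pairs 'I_n -> injective phi ->
  (forall w, #|[set f | adj E w (phi f)]| < D * r.+1)%N ->
  (forall f g, ~~ adj E (phi f) (phi g)) ->
  ((quarter r).+1 * block_size D r <= tc r E)%N.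
Proof.
move=> D0 b0 EP inj sp ind.
have Kbq : (9 * D * block_size D r <= quarter r)%N by rewrite mulnC leq_divM.
have q0 : (0 < quarter r)%N by apply: leq_trans Kbq; rewrite !muln_gt0 D0.
have qr : (4 * quarter r <= r.-1)%N by rewrite mulnC leq_divM.
have rq : (r.-1 < (quarter r).+1 * 4)%N by exact: ltn_ceil.
apply: (@tc_lower _ _ _ _ _ phi) => //; first by lia.
move=> w; apply: leq_trans (_ : 9 * D * quarter r * (block_size D r).-1 ^ quarter r <= _)%N.
  rewrite leq_mul2r; apply/orP; right; apply: leq_trans (ltnW (sp w)) _; nia.
rewrite mulnAC (mulnC (quarter r)) leq_mul2r; apply/orP; right.
exact: expn_pred_bound.
Qed.

Lemma prob_tc_lower (R : realType) n D r N (p : R) :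
  let k := (D * r.+1)%N in let m := #|template D r| in
  0 <= p <= 1 -> (0 < D)%N -> (0 < N)%N -> (m <= N)%N ->
  (N ^ (16 * k) <= n < N.+1 ^ (16 * k))%N ->
  p ^+ k * n%:R <= (16 * k * 2 ^ m.+1)%:R^-1 * ln n%:R ->
  (0 < r)%N -> (0 < n)%N ->
  1 - (m ^ 2 + 2)%:R / N%:R <=
  bprob p (pairs 'I_n) (fun E => r ^ 2 <= 32 * (9 * D) ^ 2 * tc r E)%N.
Proof.
move=> k m p01 D0 N0 mN Nn small r0 n0.
have k0 : (0 < k)%N by rewrite muln_gt0 D0.
have [phi [inj]] := prob_candidate p01 k0 N0 mN Nn small.
move=> h; apply: le_trans h _; apply: le_bprob => // E EP.
move=> /existsP[i /andP[/forallP sp /forallP ind]].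
apply: leq_trans (quarter_block_bound r0 D0) _; rewrite leq_mul2l; apply/orP; right.
case: ifP => [b0|_]; last by apply: tc_gt0; rewrite ?card_ord.
apply: (tc_lower_of_candidate D0 b0 EP (inj i)) => // f g.
by move/forallP: (ind f).
Qed.

Lemma gnp_probE (R : realType) n (p : R) (A : pred {set {set 'I_n}}) :
  gnp_prob p A = bprob p (pairs 'I_n) A.
Proof.
rewrite /gnp_prob /bprob /bexp big_mkcondr /=; apply: eq_bigr => E _.
by case: (A E); rewrite ?mulr1 ?mulr0.
Qed.

(** Raising the lower bound on the density to the power r. *)
Lemma powR_invX (R : realType) (x y : R) r : (0 < r)%N -> 0 <= x ->
  x `^ (r%:R)^-1 < y -> x < y ^+ r.
Proof.
move=> r0 x0 xy.
have y0 : 0 <= y by apply: le_trans (ltW xy); exact: powR_ge0.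
rewrite -{1}(powRr1 x0) -(@mulVf _ (r%:R : R)) ?pnatr_eq0 -?lt0n // powRrM.
by rewrite powR_mulrn ?powR_ge0 // ltrXn2r ?nnegrE ?powR_ge0 // -lt0n r0.
Qed.

(** Raising the upper bound on the density, which is at most 1, to an integral
power k that is at least the real exponent e. *)
Lemma powR_invX_le (R : realType) (x y e : R) k : 0 <= x -> 0 < y <= 1 ->
  0 < e <= k%:R -> y < x `^ e^-1 -> y ^+ k <= x.
Proof.
move=> x0 /andP[y0 y1] /andP[e0 ek] yx.
rewrite -(powR_mulrn _ (ltW y0)); apply: le_trans (_ : y `^ e <= _).
  by apply: ger_powR => //; rewrite y0.
rewrite -[leRHS](powRr1 x0) -(@mulVf _ e) ?gt_eqF // powRrM.
by apply: ge0_ler_powR; rewrite ?nnegrE ?powR_ge0 // ltW.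
Qed.

Local Open Scope classical_set_scope.
Local Open Scope ring_scope.

Theorem theorem1p3 (R : realType) (d : R) (d_gt1 : 1 < d) :
  exists alpha beta : R, 0 < alpha /\ 0 < beta /\
  forall r : nat, (0 < r)%N ->
  exists c C : R, 0 < c /\ 0 < C /\
  forall p : nat -> R,
    (forall n, 0 <= p n <= 1) ->
    (\forall n \near \oo,
        (C * ln n%:R / n%:R) `^ (r%:R)^-1 < p n
        /\ p n < (c * ln n%:R / n%:R) `^ (d * (r.+1)%:R)^-1) ->
    (fun n : nat =>
       gnp_prob (p n) (fun E : {set {set 'I_n}} =>
         alpha * r%:R ^+ 2 <= (tc r E)%:R <= beta * r%:R ^+ 2))
      @ \oo --> (1 : R).
Proof.
(* As p n <= 1, the exponent d may be enlarged to an integer. *)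
pose D := (Num.truncn d).+1.
have dD : d <= D%:R.
  have /andP[_ /ltW] // : (Num.truncn d)%:R <= d < D%:R by apply: truncn_itv; lra.
have D0 : (0 < D)%N by [].
have A0 : 0 < (32 * (9 * D) ^ 2)%:R :> R by rewrite ltr0n muln_gt0 expn_gt0 muln_gt0.
exists (32 * (9 * D) ^ 2)%:R^-1, 4; split; first by rewrite invr_gt0.
split=> // r r0.
pose k := (D * r.+1)%N; pose m := #|template D r|.
have k0 : (0 < k)%N by rewrite muln_gt0 D0.
exists (16 * k * 2 ^ m.+1)%:R^-1, (20 * ((2 * r) ^ r + r + 2))%:R.
split; first by rewrite invr_gt0 ltr0n muln_gt0 expn_gt0 andbT muln_gt0 k0.
split; first by rewrite ltr0n muln_gt0 !addnS.
move=> p p01 hp; apply/cvgrPdist_le => eps eps0.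
(* The lower bound fails with probability at most (m ^ 2 + 2) / N, where N is
   the integer root of n; N >= N0 makes this at most eps / 2. *)
pose N0 := maxn m.+1 (Num.truncn ((m ^ 2 + 2)%:R * 2 / eps)).+1.
near=> n.
have n_r : (4 * r <= n)%N by near: n; exact: nbhs_infty_ge.
have n0 : (0 < n)%N by apply: leq_trans n_r; rewrite muln_gt0.
have nR : 0 < n%:R :> R by rewrite ltr0n.
have n_ln : 1 <= ln n%:R :> R.
  rewrite -[leLHS]expRK ler_ln ?posrE ?expR_gt0 //.
  have : (Num.truncn (expR 1 : R)).+1%:R <= n%:R :> R.
    by rewrite ler_nat; near: n; exact: nbhs_infty_ge.
  apply: le_trans; apply: ltW.
  by have /andP[] := truncn_itv (expR_ge0 (1 : R)).
have n_eps : 3 / n%:R <= eps / 2.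
  have : (Num.truncn (6 / eps)).+1%:R <= n%:R :> R.
    by rewrite ler_nat; near: n; exact: nbhs_infty_ge.
  have /andP[_ lt] := truncn_itv (divr_ge0 (ler0n R 6) (ltW eps0)).
  move=> /(lt_le_trans lt) /ltW; rewrite ler_pdivrMr // ler_pdivrMr //; lra.
have n_N0 : (N0 ^ (16 * k) <= n)%N by near: n; exact: nbhs_infty_ge.
have [plo phi] : (((20 * ((2 * r) ^ r + r + 2))%:R * ln n%:R / n%:R) `^ (r%:R)^-1 < p n
   /\ p n < ((16 * k * 2 ^ m.+1)%:R^-1 * ln n%:R / n%:R) `^ (d * (r.+1)%:R)^-1).
  by near: n; exact: hp.
have ln0 : 0 <= ln n%:R :> R by lra.
have k16 : (0 < 16 * k)%N by rewrite muln_gt0.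
have [N N_gt0 Nn] := integer_root n0 k16.
have N0N : (N0 <= N)%N.
  rewrite -ltnS -(ltn_exp2r _ _ k16); apply: leq_ltn_trans n_N0 _.
  by case/andP: Nn.
have mN : (m <= N)%N by apply: leq_trans N0N; rewrite /N0 leq_max leqnSn.
have N_eps : (m ^ 2 + 2)%:R / N%:R <= eps / 2.
  have : (Num.truncn ((m ^ 2 + 2)%:R * 2 / eps)).+1%:R <= N%:R :> R.
    by rewrite ler_nat; apply: leq_trans N0N; rewrite /N0 leq_max leqnn orbT.
  have ge0 : 0 <= (m ^ 2 + 2)%:R * 2 / eps by rewrite divr_ge0 ?mulr_ge0 // ltW.
  have /andP[_ lt] := truncn_itv ge0.
  by move=> /(lt_le_trans lt) /ltW; rewrite ler_pdivrMr // ler_pdivrMr ?ltr0n //; lra.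
have p0 : 0 < p n by apply: le_lt_trans plo; exact: powR_ge0.
have [p_ge0 p1] := andP (p01 n).
have up : 1 - 3 / n%:R <= bprob (p n) (pairs 'I_n) (fun E => (tc r E <= 4 * r ^ 2)%N).
  apply: prob_tc_upper => //.
  rewrite -ler_pdivrMr //; apply/ltW/powR_invX => //.
  by rewrite divr_ge0 ?mulr_ge0 // ltW.
have lo : 1 - (m ^ 2 + 2)%:R / N%:R <=
    bprob (p n) (pairs 'I_n) (fun E => r ^ 2 <= 32 * (9 * D) ^ 2 * tc r E)%N.
  apply: prob_tc_lower => //; rewrite -ler_pdivlMr //.
  apply: powR_invX_le phi; rewrite ?p0 //.
    by rewrite !mulr_ge0 ?invr_ge0 // ltW.
  by rewrite mulr_gt0 ?ltr0n //= ?natrM ?ler_wpM2r //; lra.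
rewrite gnp_probE ger0_norm ?subr_ge0 ?bprob_le1 //.
rewrite -bprobC //.
apply: le_trans (_ : bprob (p n) (pairs 'I_n) (fun E =>
   ~~ (tc r E <= 4 * r ^ 2)%N || ~~ (r ^ 2 <= 32 * (9 * D) ^ 2 * tc r E)%N) <= _).
  apply: le_bprob => // E _; rewrite -negb_and; apply: contra => /andP[tu tl].
  apply/andP; split; last by rewrite -natrX -(natrM _ 4) ler_nat.
  by rewrite mulrC ler_pdivrMr // mulrC -natrX -natrM ler_nat.
apply: le_trans (bprobU (p01 n) _ _ _) _; rewrite !bprobC //; lra.
Unshelve. all: by end_near.
Qed.
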